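(* 1. Let $X\sim\mathcal{EC}_p(0,\Sigma)$ be a vector of $p$ standard elliptical variables, where $\Sigma$ is a $p\times p$ positive semi-definite matrix with unit diagonal entries and $\mathrm{rank}(\Sigma)=d$ ($\Sigma$ being otherwise arbitrary for each $p,d$), and let $u_d$ be the normalizing constants of the associated norm $\|Z\|_2^2$ (see context). Then $\|X\|_\infty=\max_{1\le j\le p}|X_j|$ satisfies, for any fixed $\delta>0$, $$\lim_{p,d\to\infty}\mathbb{P}\Big(\|X\|_\infty\big/\sqrt{u_d(1-p^{-2/(d-1)})}>1+\delta\Big)=0.$$ 2. In particular, let $X\sim\mathcal{N}_p(0,\Sigma)$ be a vector of $p$ standard Gaussian variables, where $\Sigma$ has unit diagonal and $\mathrm{rank}(\Sigma)=d$. Then for any fixed $\delta>0$, $$\lim_{p,d\to\infty}\mathbb{P}\Big(\|X\|_\infty\big/\sqrt{d(1-p^{-2/(d-1)})}>1+\delta\Big)=0.$$ If further $d=d(p)$ with $\lim_{p\to\infty}(\log\log p)^2d/(\log p)^2=\infty$, then $$\lim_{p\to\infty}\mathbb{P}\Big(\|X\|_\infty\big/\sqrt{d(1-p^{-2/(d-1)})}\le 1\Big)=1.$$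
   Context: A $p$-dimensional random vector $V$ is elliptically distributed, $V\sim\mathcal{EC}_p(\xi,\Theta)$, if its density satisfies $f(v)\propto g((v-\xi)^T\Theta^{-1}(v-\xi))$ for some continuous integrable function $g$. For $\Sigma$ positive semi-definite with unit diagonal and rank $d$, write $\Sigma=L^TL$ with $L=[L_1,\ldots,L_p]$ a $d\times p$ matrix whose columns are unit vectors in $\mathbb{R}^d$; then $X\sim\mathcal{EC}_p(0,\Sigma)$ means $X=L^TZ$ (in distribution) with $Z\sim\mathcal{EC}_d(0,I)$. One has $Z=\|Z\|_2U$ with $U$ uniform on $S^{d-1}$ and $\|Z\|_2$ independent of $U$; the law of $\|Z\|_2$ depends only on $d$. Standing assumption: there are sequences of positive constants $u_d,v_d$ depending only on $d$ and a proper (almost surely finite) random variable $F_\infty$ such that, as $d\to\infty$, $(\|Z\|_2^2-u_d)/v_d\to F_\infty$ in distribution and $\|Z\|_2^2/u_d\to1$ in probability. (In the Gaussian case $\|Z\|_2^2\sim\chi^2_d$ and $u_d=d$.) The notation $\lim_{p,d\to\infty}$ denotes the double limit as $p$ and $d$ tend to infinity jointly (with $d\le p$). *)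

(* Defs.v *)
From HB Require Import structures.
From mathcomp Require Import all_boot all_order all_algebra.
From mathcomp Require Import all_classical all_reals all_analysis.

Set Implicit Arguments.
Unset Strict Implicit.
Unset Printing Implicit Defensive.

Import Order.TTheory GRing.Theory Num.Theory.
Import numFieldNormedType.Exports.

Local Open Scope classical_set_scope.
Local Open Scope ring_scope.

Section cons_measure.
Context d (T : measurableType d) (R : realType) (n : nat).
Variable mu : {sigma_finite_measure set T -> \bar R}.
Variable nu : {sigma_finite_measure set (n.-tuple T) -> \bar R}.

Definition tuple_cons (x : T * n.-tuple T) : n.+1.-tuple T :=
  [tuple of x.1 :: x.2].

Let measurable_tuple_cons : measurable_fun setT tuple_cons.
Proof. exact: measurable_cons. Qed.

Definition cons_measure (A : set (n.+1.-tuple T)) : \bar R :=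
  (mu \x nu)%E (tuple_cons @^-1` A).

Let cons_measure0 : cons_measure set0 = 0%E.
Proof. by rewrite /cons_measure preimage_set0 measure0. Qed.

Let cons_measure_ge0 A : (0 <= cons_measure A)%E.
Proof. exact: measure_ge0. Qed.

Let cons_measure_sigma_additive : semi_sigma_additive cons_measure.
Proof.
move=> F mF tF mUF; rewrite /cons_measure preimage_bigcup.
apply: measure_semi_sigma_additive.
- by move=> k; rewrite -[X in measurable X]setTI; exact: measurable_tuple_cons.
- apply/trivIsetP => /= i j _ _ ij; rewrite -preimage_setI.
  by move/trivIsetP : tF => /(_ _ _ _ _ ij) ->//; rewrite preimage_set0.
- by rewrite -preimage_bigcup -[X in measurable X]setTI;
    exact: measurable_tuple_cons.
Qed.

HB.instance Definition _ := isMeasure.Build _ _ _ cons_measure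
  cons_measure0 cons_measure_ge0 cons_measure_sigma_additive.

Let cons_measure_sigma_finite : sigma_finite setT cons_measure.
Proof.
have /sigma_finiteP[G [TG ndG finG]] := sigma_finiteT mu.
have /sigma_finiteP[H [TH ndH finH]] := sigma_finiteT nu.
pose F k := G k `*` H k.
have UF : setT = \bigcup_k F k.
  apply/esym; rewrite -subTset => -[x y] _.
  have [k _ Gkx] : (\bigcup_k G k) x by rewrite -TG.
  have [l _ Hly] : (\bigcup_k H k) y by rewrite -TH.
  exists (maxn k l) => //; split.
    by move: Gkx; exact/subsetPset/ndG/leq_maxl.
  by move: Hly; exact/subsetPset/ndH/leq_maxr.
have finF k : measurable (F k) /\ ((mu \x nu)%E (F k) < +oo)%E.
  have [mG Gk] := finG k; have [mH Hk] := finH k.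
  split; first exact: measurableX.
  by rewrite product_measure1E// lte_mul_pinfty// ge0_fin_numE.
pose un (t : n.+1.-tuple T) : T * n.-tuple T := (thead t, [tuple of behead t]).
have mun : measurable_fun setT un.
  apply/measurable_fun_pairP; split.
    exact: measurable_tnth.
  exact: measurable_behead.
have unK x : un (tuple_cons x) = x.
  by case: x => x t; rewrite /un /tuple_cons /=; congr pair; apply: val_inj.
exists (fun k => un @^-1` F k).
  by rewrite -preimage_bigcup -UF preimage_setT.
move=> k; have [mF Fk] := finF k; split.
  by rewrite -[X in measurable X]setTI; exact: mun.
rewrite /cons_measure -comp_preimage (_ : un \o tuple_cons = id)//.
exact/funext.
Qed.

HB.instance Definition _ := Measure_isSigmaFinite.Build _ _ _ cons_measure
  cons_measure_sigma_finite.

End cons_measure.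

(* The n-fold product measure on T^n: iterate nu |-> image of mu \x nu by cons. *)
Fixpoint power_measure d (T : measurableType d) (R : realType)
    (mu : {sigma_finite_measure set T -> \bar R}) (n : nat) :
    {sigma_finite_measure set (n.-tuple T) -> \bar R} :=
  match n with
  | 0 => dirac [tuple]
  | m.+1 => cons_measure mu (power_measure mu m)
  end.

(* R^n with its Borel sigma-algebra (the product of the one of [lebesgue_measure]). *)
Notation rvec R n := (n.-tuple (measurableTypeR R)).

Section vectors.
Context {R : realType}.

Definition col_of_tuple n (x : rvec R n) : 'cV[R]_n := \col_i tnth x i.

Definition mx_map m n (A : 'M[R]_(m, n)) (x : rvec R n) : rvec R m :=
  [tuple (A *m col_of_tuple x) i 0 | i < m].

Definition sqnorm n (x : rvec R n) : R := \sum_(i < n) tnth x i ^+ 2.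

Definition supnorm n (x : rvec R n) : R :=
  \big[Num.max/0]_(i < n) `|tnth x i|.

Definition psdmx n (S : 'M[R]_n) : Prop :=
  S^T = S /\ forall v : 'cV[R]_n, 0 <= (v^T *m S *m v) 0 0.

Definition correlation_mx n (S : 'M[R]_n) : Prop :=
  psdmx S /\ forall i, S i i = 1.

Definition rank_bound (u : R) (p d : nat) : R :=
  Num.sqrt (u * (1 - p%:R `^ (- 2 / (d%:R - 1)))).

End vectors.

Section laws.
Context {R : realType} d (T : measurableType d) (P : probability T R).

Definition has_density n (V : {RV P >-> rvec R n}) (f : rvec R n -> R) : Prop :=
  [/\ measurable_fun setT f, forall x, 0 <= f x &
      forall A, measurable A -> distribution P V A =
        (\int[power_measure (@lebesgue_measure R) n]_(x in A) (f x)%:E)%E].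

(* Only the values of [g] on [0, +oo[ matter; [c] is the normalizing constant. *)
Definition elliptical n (V : {RV P >-> rvec R n})
    (xi : 'cV[R]_n) (Theta : 'M[R]_n) : Prop :=
  Theta \in unitmx /\ exists (g : R -> R) (c : R),
    [/\ {within `[0, +oo[, continuous g},
        (@lebesgue_measure R).-integrable `[0, +oo[ (EFin \o g) &
        has_density V (fun x => let y := col_of_tuple x - xi in
          c * g ((y^T *m invmx Theta *m y) 0 0))].

(* [X] is distributed as [L^T Z], where [Z] has law [m] and [S = L^T L].
   When [S] has unit diagonal the columns of [L] are unit vectors. *)
Definition factor_law k p (m : set (rvec R k) -> \bar R)
    (X : {RV P >-> rvec R p}) (S : 'M[R]_p) : Prop :=
  exists2 L : 'M[R]_(k, p), S = L^T *m L &
    forall A, measurable A ->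
      distribution P X A = pushforward m (mx_map L^T) A.

(* N_p(0, S) for a possibly singular [S]. *)
Definition centered_normal p (X : {RV P >-> rvec R p}) (S : 'M[R]_p) : Prop :=
  factor_law (power_measure (normal_prob (0 : R) 1) (\rank S)) X S.

End laws.

(* The random variables of a sequence may live on different probability spaces. *)
Section convergence.
Context {R : realType} (dT : nat -> measure_display)
  (T : forall n, measurableType (dT n)) (P : forall n, probability (T n) R).

Definition cvg_in_distribution (X : forall n, T n -> R)
    d (U : measurableType d) (Q : probability U R) (F : {RV Q >-> R}) : Prop :=
  forall r : R, {for r, continuous (cdf F)} ->
    P n [set w | X n w <= r] @[n --> \oo] --> cdf F r.

Definition cvg_in_probability (X : forall n, T n -> R) (a : R) : Prop :=
  forall e : R, 0 < e ->
    P n [set w | e < `|X n w - a|] @[n --> \oo] --> 0%E.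

End convergence.

(* p and d tend to infinity jointly, with 1 <= d <= p. *)
Definition joint_oo : set_system (nat * nat) :=
  within [set pd | (0 < pd.2 <= pd.1)%N] (filter_prod \oo \oo).

(* Main.v *)
(* Write X = L^T Z, with unit columns l of L. For a spherical Z in dimension d,
   the event |<l, Z>| > s |Z| depends only on the direction of Z, so its
   probability is the proportion of the unit ball lying in a double cone; slicing
   that cone parallel to its axis gives the bound
   sqrt 8 * (1 - s^2)^((d-1)/2) / (s sqrt d). At s = t := sqrt (1 - p^(-2/(d-1)))
   this is sqrt 8 / (p t sqrt d), so a union bound over the p columns leaves
   sqrt 8 / (t sqrt d), which is at most sqrt (4 / ln p + 8 / d) and vanishes in
   the joint limit; the factor 1 + delta absorbs the fluctuation of |Z| around
   sqrt u_d. In the last part |Z| <= sqrt d / (1 - eps) fails with probability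
   exp (1/4 - eps sqrt d / 2), and shrinking the cone to s = (1 - eps) t costs a
   factor exp (4 eps ln p); the choice eps = ln (ln p) / (16 ln p) makes that
   factor (ln p)^(1/4), beaten by 1 / (t sqrt d) ~ (ln p)^(-1/2), while
   eps sqrt d tends to infinity exactly under the growth hypothesis on d. *)

Require Import Defs.
From HB Require Import structures.
From mathcomp Require Import all_boot all_order all_algebra.
From mathcomp Require Import all_classical all_reals all_analysis.
From mathcomp Require Import measurable_realfun ring lra.

Set Implicit Arguments.
Unset Strict Implicit.
Unset Printing Implicit Defensive.

Import Order.TTheory GRing.Theory Num.Theory.
Import numFieldNormedType.Exports.

Local Open Scope classical_set_scope.
Local Open Scope ring_scope.

(** * Integration over powers of the real line *)

Section affine.
Context {R : realType}.
Local Notation leb := (@lebesgue_measure R).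
Implicit Types (f : measurableTypeR R -> \bar R) (a b : R).

Let affine_measurable (a b : R) :
  measurable_fun setT ((fun x => a * x + b) : measurableTypeR R -> measurableTypeR R).
Proof. by apply: measurable_funD => //; apply: measurable_funM. Qed.

(** The image of Lebesgue measure under [a * x + b], multiplied by [a], agrees with Lebesgue measure
    on half-open intervals, hence everywhere. *)
Let integral_affine_gt0 f a b : 0 < a -> measurable_fun setT f ->
  (forall x, 0 <= f x)%E ->
  (\int[leb]_x f (a * x + b)%R = a^-1%:E * \int[leb]_x f x)%E.
Proof.
move=> a0 mf f0.
have ai0 : 0 <= a^-1 by rewrite invr_ge0 ltW.
pose phi : measurableTypeR R -> measurableTypeR R := fun x => a * x + b.
pose ph : {mfun measurableTypeR R >-> measurableTypeR R} := HB.pack phi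
  (isMeasurableFun.Build _ _ _ _ phi (@affine_measurable a b)).
transitivity (\int[mscale (NngNum ai0) leb]_x f x)%E; last first.
  by rewrite ge0_integral_mscale.
transitivity (\int[pushforward leb ph]_x f x)%E.
  by rewrite (@ge0_integral_pushforward _ _ _ _ _ ph).
apply: eq_measure_integral => A mA _.
pose m0 : {measure set (measurableTypeR R) -> \bar R} :=
  mscale (NngNum (ltW a0)) (pushforward leb ph).
pose m := m0 (@affine_measurable a b).
suff lebA : leb A = m A.
  transitivity (a^-1%:E * leb A)%E => //.
  by rewrite lebA /m /mscale/= muleA -EFinM mulVf ?mul1e// gt_eqF.
apply: (@lebesgue_measure_unique _ m) => // _ [[u v]] _ <-.
rewrite /m /= /mscale/= /pushforward.
have -> : ph @^-1` `]u, v] = `](u - b) / a, (v - b) / a]%classic.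
  apply/seteqP; split => x; rewrite /= !in_itv/= ltr_pdivrMr// ler_pdivlMr//;
  by rewrite ltrBlDr lerBrDr mulrC.
rewrite !lebesgue_measure_itv/= !lte_fin ltr_pM2r ?invr_gt0// ltrD2r.
case: ifPn => _; last by rewrite mule0.
rewrite -!EFinB -EFinM; congr EFin; field.
by rewrite gt_eqF.
Qed.

Lemma integral_affine f a b : a != 0 -> measurable_fun setT f ->
  (forall x, 0 <= f x)%E ->
  (\int[leb]_x f (a * x + b)%R = `|a|^-1%:E * \int[leb]_x f x)%E.
Proof.
move=> aN0 mf f0; have := aN0; rewrite neq_lt => /orP[a0|a0]; last first.
  by rewrite integral_affine_gt0// gtr0_norm.
have mN : measurable_fun setT (-%R : measurableTypeR R -> measurableTypeR R).
  exact: measurable_funN.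
transitivity (\int[leb]_x (f \o -%R) ((- a) * x + (- b))%R)%E.
  by apply: eq_integral => x _ /=; congr f; ring.
rewrite (@integral_affine_gt0 (f \o -%R)) ?oppr_gt0//; last first.
- by move=> x; exact: f0.
- exact: measurableT_comp mN.
rewrite ltr0_norm//; congr (_ * _)%E.
transitivity (\int[pushforward leb (-%R : measurableTypeR R -> measurableTypeR R)]_x f x)%E.
  by rewrite (@ge0_integral_pushforward _ _ _ _ _ (-%R : measurableTypeR R -> measurableTypeR R)).
by apply: eq_measure_integral => A mA _; exact: lebesgue_measureN.
Qed.

End affine.

Section power_integral.
Context d (T : measurableType d) (R : realType).
Context (mu : {sigma_finite_measure set T -> \bar R}).

(** [power_measure mu n.+1] is the image of a product measure under [tuple_cons], so this is Tonelli
    after a change of variables. The inductions on the dimension go through it. *)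
Lemma integral_powerS n (f : n.+1.-tuple T -> \bar R) :
  measurable_fun setT f -> (forall x, 0 <= f x)%E ->
  (\int[power_measure mu n.+1]_x f x =
   \int[mu]_x \int[power_measure mu n]_y f [tuple of x :: y])%E.
Proof.
move=> mf f0.
have mc : measurable_fun setT (@tuple_cons _ T n) by exact: measurable_cons.
pose c : {mfun (T * n.-tuple T)%type >-> n.+1.-tuple T} := HB.pack (@tuple_cons _ T n)
  (isMeasurableFun.Build _ _ _ _ _ mc).
transitivity (\int[pushforward (mu \x power_measure mu n)%E c]_x f x)%E.
  exact: eq_measure_integral.
rewrite (@ge0_integral_pushforward _ _ _ _ _ c)//=.
by rewrite preimage_setT fubini_tonelli1//; exact: measurableT_comp.
Qed.

Lemma measurable_integral_param d' (S : measurableType d') n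
    (f : S -> n.-tuple T -> \bar R) :
  measurable_fun setT (fun p => f p.1 p.2) -> (forall x y, 0 <= f x y)%E ->
  measurable_fun setT (fun x => \int[power_measure mu n]_y f x y)%E.
Proof.
move=> mf f0.
exact: (@measurable_fun_fubini_tonelli_F _ _ _ _ _ _ (fun p => f p.1 p.2)).
Qed.

End power_integral.

Section sqnorm.
Context {R : realType}.
Local Notation leb := (@lebesgue_measure R).

Lemma sqnorm_cons n (x : measurableTypeR R) (y : rvec R n) :
  sqnorm [tuple of x :: y] = x ^+ 2 + sqnorm y.
Proof.
rewrite /sqnorm big_ord_recl tnth0; congr (_ + _).
by apply: eq_bigr => i _; rewrite tnthS.
Qed.

Lemma sqnorm_ge0 n (x : rvec R n) : 0 <= sqnorm x.
Proof. by apply: sumr_ge0 => i _; exact: sqr_ge0. Qed.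

Lemma measurable_sqnorm n : measurable_fun setT (@sqnorm R n).
Proof.
apply: measurable_sum => i; apply: measurable_funX.
exact: measurable_tnth.
Qed.

Definition dot n (l : 'I_n -> R) (x : rvec R n) : R := \sum_i l i * tnth x i.

Lemma dot_cons n (l : 'I_n.+1 -> R) (x : measurableTypeR R) (y : rvec R n) :
  dot l [tuple of x :: y] = l ord0 * x + dot (l \o lift ord0) y.
Proof.
rewrite /dot big_ord_recl tnth0; congr (_ + _).
by apply: eq_bigr => i _; rewrite tnthS.
Qed.

Lemma measurable_dot n (l : 'I_n -> R) : measurable_fun setT (dot l).
Proof.
apply: measurable_sum => i; apply: measurable_funM => //.
exact: measurable_tnth.
Qed.

End sqnorm.

(** Syntax-directed; the last resort composes with a measurability hypothesis of the context, which
    handles abstract integrands. *)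
Ltac mfun := repeat lazymatch goal with
  | |- measurable_fun _ (fun _ => (_, _)) => apply: measurable_fun_pair
  | |- measurable_fun _ (fun _ => _ + _) => apply: measurable_funD
  | |- measurable_fun _ (+%R _) => apply: measurable_funD
  | |- measurable_fun _ ( *%R _) => apply: measurable_funM
  | |- measurable_fun _ (fun _ => - _) => apply: measurable_funN
  | |- measurable_fun _ (fun _ => _ * _) => apply: measurable_funM
  | |- measurable_fun _ (fun _ => _ ^+ _) => apply: measurable_funX
  | |- measurable_fun _ (fun _ => sqnorm _) =>
      apply: (measurableT_comp (@measurable_sqnorm _ _))
  | |- measurable_fun _ (fun _ => dot _ _) =>
      apply: (measurableT_comp (@measurable_dot _ _ _))
  | |- measurable_fun _ (fun _ => [tuple of _ :: _]) => apply: measurable_cons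
  | |- _ => first
    [ exact: measurable_cst | exact: measurable_id
    | exact: measurable_fst | exact: measurable_snd
    | exact: measurable_sqnorm | exact: measurable_dot
    | match goal with
      | H : measurable_fun _ _ |- measurable_fun _ _ =>
          apply: (measurableT_comp H)
      end ]
  end.

Section sqnorm_integral.
Context {R : realType}.
Local Notation leb := (@lebesgue_measure R).
Local Notation mu n := (power_measure leb n).
Local Notation RR := (measurableTypeR R).

Lemma integral_sqnormS n (k : RR -> \bar R) :
  measurable_fun setT k -> (forall x, 0 <= k x)%E ->
  (\int[mu n.+1]_x k (sqnorm x) =
   \int[leb]_x \int[mu n]_y k (x ^+ 2 + sqnorm y)%R)%E.
Proof.
move=> mk k0; rewrite integral_powerS; [|by mfun|by move=> x; exact: k0].
by apply: eq_integral => x _; apply: eq_integral => y _; rewrite sqnorm_cons.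
Qed.

(** Each coordinate contributes one factor [c^-1]. The induction ranges over all kernels [k],
    because the first coordinate is frozen and absorbed into the kernel. *)
Lemma integral_sqnorm_scale n (k : RR -> \bar R) (c : R) : 0 < c ->
  measurable_fun setT k -> (forall x, 0 <= k x)%E ->
  (\int[mu n]_x k (c ^+ 2 * sqnorm x)%R =
   (c^-1 ^+ n)%:E * \int[mu n]_x k (sqnorm x))%E.
Proof.
move=> c0; elim: n k => [|n IH] k mk k0.
  rewrite expr0 mul1e; apply: eq_integral => x _.
  by rewrite /sqnorm big_ord0 mulr0.
rewrite integral_sqnormS// (@integral_sqnormS _ (fun q => k (c ^+ 2 * q)%R))//;
  last by mfun.
transitivity (\int[leb]_x ((c^-1 ^+ n)%:E *
    \int[mu n]_y k ((c * x + 0) ^+ 2 + sqnorm y)%R))%E.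
  apply: eq_integral => x _.
  rewrite -(IH (fun q => k ((c * x + 0) ^+ 2 + q)%R))//; last by mfun.
  apply: eq_integral => y _; congr k; ring.
rewrite ge0_integralZl_EFin; last 4 first.
- exact: measurableT.
- by move=> x _; exact: integral_ge0.
- apply: (@measurable_integral_param _ _ _ _ _ _ _
    (fun (x : RR) y => k ((c * x + 0) ^+ 2 + sqnorm y)%R)) => //.
  by mfun.
- by rewrite exprn_ge0// invr_ge0 ltW.
rewrite (@integral_affine _ (fun x => \int[mu n]_y k (x ^+ 2 + sqnorm y)%R)%E)
  ?gt_eqF//; last 2 first.
- apply: (@measurable_integral_param _ _ _ _ _ _ _
    (fun (x : RR) y => k (x ^+ 2 + sqnorm y)%R)) => //.
  by mfun.
- by move=> x; exact: integral_ge0.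
by rewrite muleA -EFinM gtr0_norm// exprSr.
Qed.

(* Substitute [u = a x + b s] for [s], then [v = a s - b x] for [x]. *)
Lemma integral_rotation2 (H : RR * RR -> \bar R) (a b : R) :
  a ^+ 2 + b ^+ 2 = 1 -> b != 0 -> measurable_fun setT H -> (forall x, 0 <= H x)%E ->
  (\int[leb]_x \int[leb]_s H (a * x + b * s, x ^+ 2 + s ^+ 2)%R =
   \int[leb]_x \int[leb]_s H (x, x ^+ 2 + s ^+ 2)%R)%E.
Proof.
move=> ab b0 mH H0.
(* After [u = a x + b s], the orthogonal coordinate [a s - b x] reads [- x / b + a u / b], affine in
   [x] for fixed [u]. The Jacobians [1 / |b|] and [|b|] of the two substitutions cancel. *)
pose G (x u : RR) := H (u, u ^+ 2 + (- b^-1 * x + a * u / b) ^+ 2).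
have mG : measurable_fun setT (fun p => G p.1 p.2) by rewrite /G; mfun.
have G0 x u : (0 <= G x u)%E by exact: H0.
transitivity (\int[leb]_x (`|b|^-1%:E * \int[leb]_u G x u))%E.
  apply: eq_integral => x _.
  have mGx : measurable_fun setT (G x) by rewrite /G; mfun.
  rewrite -(@integral_affine _ (G x) b (a * x))//.
  apply: eq_integral => s _; rewrite /G; congr (H (_, _)); first by ring.
  have -> : - b^-1 * x + a * (b * s + a * x) / b = a * s - b * x.
    rewrite -[X in - b^-1 * X](mul1r) -ab; field => //.
  transitivity ((a ^+ 2 + b ^+ 2) * (x ^+ 2 + s ^+ 2)); last by ring.
  by rewrite ab mul1r.
rewrite ge0_integralZl_EFin//; last 2 first.
- by move=> x _; apply: integral_ge0 => u _; exact: G0.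
- exact: (@measurable_fun_fubini_tonelli_F _ _ _ _ _ _ (fun p => G p.1 p.2)).
rewrite (fubini_tonelli (fun p => G p.1 p.2))//=.
rewrite -ge0_integralZl_EFin//; last 2 first.
- by move=> x _; apply: integral_ge0 => u _; exact: G0.
- exact: (@measurable_fun_fubini_tonelli_G _ _ _ _ _ _ (fun p => G p.1 p.2)).
apply: eq_integral => u _.
rewrite (@integral_affine _ (fun v => H (u, u ^+ 2 + v ^+ 2)%R))//.
- by rewrite normrN normfV invrK muleA -EFinM mulVf ?mul1e// normr_eq0.
- by rewrite oppr_eq0 invr_eq0.
- by mfun.
Qed.

End sqnorm_integral.

(** * Rotation invariance *)

Section rotation.
Context {R : realType}.
Local Notation leb := (@lebesgue_measure R).
Local Notation mu n := (power_measure leb n).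
Local Notation RR := (measurableTypeR R).

(** The case [l = ±e_0], where the planar rotation would have [b = 0]. The sign disappears in a
    substitution of slope [l ord0], of absolute value 1. *)
Let rotation_degenerate n (l : 'I_n.+1 -> R) (F : RR * RR -> \bar R) :
  l ord0 ^+ 2 = 1 -> (forall i, l (lift ord0 i) = 0) ->
  measurable_fun setT F -> (forall p, 0 <= F p)%E ->
  (\int[mu n.+1]_x F (dot l x, sqnorm x) =
   \int[leb]_x \int[mu n]_y F (x, x ^+ 2 + sqnorm y)%R)%E.
Proof.
move=> l1 l0 mF F0.
pose G (x : RR) := (\int[mu n]_y F (x, x ^+ 2 + sqnorm y)%R)%E.
have mG : measurable_fun setT G.
  apply: (@measurable_integral_param _ _ _ _ _ _ _
    (fun (x : RR) y => F (x, x ^+ 2 + sqnorm y)%R)) => //.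
  by mfun.
have G0 x : (0 <= G x)%E by apply: integral_ge0 => y _; exact: F0.
have nl1 : `|l ord0| = 1 by rewrite -(@sqrtr_sqr R) l1 sqrtr1.
have lN0 : l ord0 != 0 by rewrite -normr_eq0 nl1 oner_neq0.
rewrite -/(G _) -[RHS]mul1e -[X in (X%:E * _)%E](invr1 R) -nl1.
rewrite -(@integral_affine _ G (l ord0) 0); [|exact: lN0|exact: mG|exact: G0].
rewrite integral_powerS; [|by mfun|by move=> x; exact: F0].
apply: eq_integral => x _; apply: eq_integral => y _.
rewrite dot_cons sqnorm_cons; congr (F (_, _)).
  by congr (_ + _); apply: big1 => i _; rewrite /= l0 mul0r.
by rewrite addr0 exprMn l1 mul1r.
Qed.

(** Write [l = a e_0 + b l'] with [l'] a unit vector: the induction hypothesis aligns [l'] with an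
    axis, and a rotation in the plane of that axis and [e_0] finishes. This is rotation invariance
    in the form the cones require: the joint image measure of [dot l x] and [sqnorm x] is the same
    for all unit [l]. *)
Lemma integral_rotation n (l : 'I_n.+1 -> R) (F : RR * RR -> \bar R) :
  \sum_i l i ^+ 2 = 1 -> measurable_fun setT F -> (forall p, 0 <= F p)%E ->
  (\int[mu n.+1]_x F (dot l x, sqnorm x) =
   \int[leb]_x \int[mu n]_y F (x, x ^+ 2 + sqnorm y)%R)%E.
Proof.
elim: n l F => [|n IH] l F l1 mF F0.
  apply: rotation_degenerate => //; last by case.
  by move: l1; rewrite big_ord1.
move: l1; rewrite big_ord_recl; set s := \sum_i _ => l1.
have s0 : 0 <= s by apply: sumr_ge0 => i _; exact: sqr_ge0.
have [sE|sN0] := eqVneq s 0.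
  apply: rotation_degenerate => //; first by rewrite -l1 sE addr0.
  move=> i; apply/eqP; rewrite -sqrf_eq0.
  by move/eqP : sE; rewrite psumr_eq0 => [/allP/(_ i)|j _]; 
    [apply; rewrite mem_index_enum|exact: sqr_ge0].
pose a := l ord0; pose b := Num.sqrt s.
have b0 : b != 0 by rewrite sqrtr_eq0 -ltNge lt_neqAle eq_sym sN0.
have ab : a ^+ 2 + b ^+ 2 = 1 by rewrite sqr_sqrtr.
pose l' i := l (lift ord0 i) / b.
have l'1 : \sum_i l' i ^+ 2 = 1.
  under eq_bigr do rewrite expr_div_n.
  by rewrite -mulr_suml sqr_sqrtr// divff.
(* Integrating out the coordinates orthogonal to the plane leaves a planar integrand, to which
   [integral_rotation2] applies. *)
pose H (p : RR * RR) := (\int[mu n]_z F (p.1, p.2 + sqnorm z)%R)%E.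
have mH : measurable_fun setT H.
  apply: (@measurable_integral_param _ _ _ _ _ _ _
    (fun (p : RR * RR) y => F (p.1, p.2 + sqnorm y)%R)) => //.
  apply: (measurableT_comp mF); apply: measurable_fun_pair; last first.
    apply: measurable_funD; last by mfun.
    exact: (measurableT_comp measurable_snd measurable_fst).
  exact: (measurableT_comp measurable_fst measurable_fst).
have H0 p : (0 <= H p)%E by apply: integral_ge0 => y _; exact: F0.
transitivity (\int[leb]_x \int[leb]_s H (a * x + b * s, x ^+ 2 + s ^+ 2)%R)%E.
  rewrite integral_powerS; [|by mfun|by move=> x'; exact: F0].
  apply: eq_integral => x _.
  transitivity (\int[mu n.+1]_y
      F (a * x + b * dot l' y, x ^+ 2 + sqnorm y)%R)%E.
    apply: eq_integral => y _; rewrite dot_cons sqnorm_cons.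
    congr (F (_ + _, _)); rewrite mulr_sumr; apply: eq_bigr => i _.
    by rewrite /l' mulrA mulrCA divff// mulr1.
  rewrite (IH l' (fun p => F (a * x + b * p.1, x ^+ 2 + p.2)%R)).
  - by apply: eq_integral => t _; apply: eq_integral => z _ /=; rewrite addrA.
  - exact: l'1.
  - by mfun.
  - by move=> p; exact: F0.
rewrite integral_rotation2//; apply: eq_integral => x _.
rewrite integral_powerS; [|by mfun|by move=> x'; exact: F0].
apply: eq_integral => t _; apply: eq_integral => z _ /=.
by rewrite sqnorm_cons addrA.
Qed.

End rotation.

(** * Volume of the unit ball and of its double cones *)

Section bool_integral.
Context d (T : measurableType d) (R : realType).
Implicit Type P : T -> bool.

Lemma measurable_bool_set P : measurable_fun setT P ->
  measurable [set x | P x].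
Proof.
move=> mP; rewrite (_ : [set x | P x] = P @^-1` [set true]).
  by rewrite -[X in measurable X]setTI; exact: mP.
by apply/seteqP; split => x /=.
Qed.

Lemma measurable_boolr P : measurable_fun setT P ->
  measurable_fun setT (fun x => (P x)%:R%:E : \bar R).
Proof.
move=> mP; rewrite (_ : (fun _ => _) = EFin \o \1_[set x | P x]).
  apply/measurable_EFinP; apply: measurable_indic.
  exact: measurable_bool_set.
by apply/funext => x; rewrite /= indicE mem_setE.
Qed.

(** Volumes are written as integrals of booleans so that Tonelli and substitutions can act on
    them. *)
Lemma integral_bool (m : {measure set T -> \bar R}) P : measurable_fun setT P ->
  (\int[m]_x (P x)%:R%:E = m [set x | P x])%E.
Proof.
move=> mP; rewrite -[in RHS](setIT [set x | P x]) -integral_indic//.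
  by apply: eq_integral => x _; rewrite indicE mem_setE.
exact: measurable_bool_set.
Qed.

End bool_integral.

Ltac mbool := repeat first
  [ apply: measurable_boolr | apply: measurable_and
  | apply: measurable_fun_ltr ]; mfun.

Section ball.
Context {R : realType}.
Local Notation leb := (@lebesgue_measure R).
Local Notation mu n := (power_measure leb n).
Local Notation RR := (measurableTypeR R).

Definition unit_ball_volume n : \bar R := mu n [set x | sqnorm x < 1].

Local Notation om := unit_ball_volume.

Lemma measure_ball n (r : R) : 0 < r ->
  mu n [set x | sqnorm x < r ^+ 2] = ((r ^+ n)%:E * om n)%E.
Proof.
move=> r0; rewrite /om -!integral_bool; try by mbool.
have := @integral_sqnorm_scale R n (fun q => (q < 1)%R%:R%:E) r^-1.
rewrite invr_gt0 invrK => <-//; last by mbool.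
apply: eq_integral => x _; congr (_%:R%:E).
by rewrite exprVn mulrC ltr_pdivrMr ?exprn_gt0// mul1r.
Qed.

Lemma measure_ball_slice n : om n.+1 =
  (\int[leb]_x mu n [set y | (sqnorm y < 1 - x ^+ 2)%R])%E.
Proof.
rewrite /om -integral_bool; last by mbool.
rewrite (@integral_sqnormS _ _ (fun q => (q < 1)%R%:R%:E))//; last by mbool.
apply: eq_integral => x _; rewrite -integral_bool; last by mbool.
by apply: eq_integral => y _; rewrite ltrBrDl.
Qed.

End ball.

Section ball_ratio.
Context {R : realType}.
Local Notation leb := (@lebesgue_measure R).
Local Notation mu n := (power_measure leb n).
Local Notation RR := (measurableTypeR R).
Local Notation om := unit_ball_volume.

Lemma bernoulli_le (t : R) n : 0 <= t <= 1 -> 1 - n%:R * t <= (1 - t) ^+ n.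
Proof.
move=> /andP[t0 t1]; elim: n => [|n IH]; first by rewrite mul0r subr0 expr0.
rewrite exprS; apply: le_trans (ler_wpM2l _ IH); last by rewrite subr_ge0.
rewrite -[n.+1%:R]natr1; have n0 : 0 <= n%:R :> R by exact: ler0n.
nra.
Qed.

Lemma measurable_ball_slice n :
  measurable_fun setT (fun x : RR => mu n [set y | (sqnorm y < 1 - x ^+ 2)%R]).
Proof.
rewrite (_ : (fun _ => _) =
    fun x : RR => (\int[mu n]_y (sqnorm y < 1 - x ^+ 2)%R%:R%:E)%E); last first.
  by apply/funext => x; rewrite integral_bool//; mbool.
apply: (@measurable_integral_param _ _ _ _ _ _ _
    (fun (x : RR) y => (sqnorm y < 1 - x ^+ 2)%R%:R%:E)) => //.
mbool.
Qed.

(* The unit ball contains a cylinder of half-height [a = (2 (n + 1))^-1/2]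
   and radius [sqrt (1 - a ^+ 2)]. *)
Lemma unit_ball_volume_leS n :
  (om n <= (Num.sqrt (2 * n.+1%:R) : R)%:E * om n.+1)%E.
Proof.
pose w : R := Num.sqrt (2 * n.+1%:R); pose a := w^-1.
have w0 : 0 < w by rewrite sqrtr_gt0 mulr_gt0.
have a0 : 0 < a by rewrite invr_gt0.
have a2 : a ^+ 2 = (2 * n.+1%:R)^-1 by rewrite exprVn sqr_sqrtr// mulr_ge0.
have n1 : 1 <= n.+1%:R :> R by rewrite ler1n.
have a21 : a ^+ 2 < 1.
  by rewrite a2 invf_lt1; [lra|rewrite mulr_gt0].
pose r := Num.sqrt (1 - a ^+ 2).
have r0 : 0 < r by rewrite sqrtr_gt0 subr_gt0.
have r2 : r ^+ 2 = 1 - a ^+ 2 by rewrite sqr_sqrtr// subr_ge0 ltW.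
(* By Bernoulli, [r ^+ (2 * n) = (1 - a ^+ 2) ^+ n >= 1 - n / (2 (n + 1)) >= 1/2], and [r <= 1]
   gives [r ^+ n >= r ^+ (2 * n)]. *)
have rn : 2^-1 <= r ^+ n.
  have t01 : 0 <= a ^+ 2 <= 1 by rewrite sqr_ge0 ltW.
  have := bernoulli_le n t01; rewrite -r2 -exprM => rn.
  have r1 : r <= 1.
    by rewrite leNgt; apply/negP => r1; have := sqr_ge0 a; nra.
  apply: (@le_trans _ _ (r ^+ (2 * n))); last first.
    by apply: ler_wiXn2l; rewrite ?(ltW r0)//; exact: leq_pmull.
  apply: le_trans rn; rewrite a2.
  rewrite -[n.+1%:R]natr1 in n1 *; set m := n%:R in n1 *.
  have -> : m * (2 * (m + 1))^-1 = 2^-1 * (m / (m + 1)).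
    by field; lra.
  suff : m / (m + 1) <= 1 by lra.
  by rewrite ler_pdivrMr; lra.
have step : ((a%:E * om n) <= om n.+1)%E.
  rewrite measure_ball_slice.
  apply: (@le_trans _ _ (\int[leb]_(x in `](- a)%R, a[)
      mu n [set y | (sqnorm y < 1 - x ^+ 2)%R])%E); last first.
    by apply: ge0_subset_integral => //; exact: measurable_ball_slice.
  apply: (@le_trans _ _ (\int[leb]_(x in `](- a)%R, a[) ((r ^+ n)%:E * om n))%E).
    rewrite integral_cst//= lebesgue_measure_itv/= lte_fin gtrN// -EFinD opprK.
    rewrite muleAC -EFinM; apply: lee_wpmul2r; first exact: measure_ge0.
    by rewrite lee_fin; nra.
  apply: ge0_le_integral => //.
  - by move=> x _; rewrite mule_ge0// ?measure_ge0// lee_fin exprn_ge0// ltW.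
  - by apply: measurable_funTS; exact: measurable_ball_slice.
  - move=> x; rewrite /= in_itv/= => /andP[xa1 xa2].
    rewrite -measure_ball//; apply: le_measure; rewrite ?inE.
    + by apply: measurable_bool_set; mbool.
    + by apply: measurable_bool_set; mbool.
    move=> y /=; rewrite r2 => /lt_le_trans; apply.
    rewrite lerD2l lerN2; nra.
apply: (@le_trans _ _ (w%:E * (a%:E * om n))%E).
  by rewrite muleA -EFinM divff ?gt_eqF// mul1e.
by apply: lee_wpmul2l; [rewrite lee_fin; exact: ltW|exact: step].
Qed.

(** Positivity climbs the dimensions through [unit_ball_volume_leS]. Together with finiteness it
    lets the ball volume be cancelled in [spherical_cap]. *)
Lemma unit_ball_volume_gt0 n : (0 < om n :> \bar R)%E.
Proof.
elim: n => [|n IH].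
  rewrite /om /= diracE mem_set//=.
  by rewrite /sqnorm big_ord0.
rewrite lt0e measure_ge0 andbT; apply: contraTneq IH => o0.
by rewrite -leNgt (le_trans (unit_ball_volume_leS n))// o0 mule0.
Qed.

Lemma unit_ball_volume_lty n : (om n < +oo :> \bar R)%E.
Proof.
elim: n => [|n IH].
  rewrite /om /= diracE.
  by case: (_ \in _); rewrite ltry.
rewrite measure_ball_slice.
apply: (@le_lt_trans _ _ (\int[leb]_(x in `](-1)%R, 1%R[) om n)%E); last first.
  rewrite integral_cst//= lebesgue_measure_itv/= lte_fin gtrN// -EFinD.
  apply: lte_mul_pinfty; [exact: measure_ge0| |exact: ltry].
  by rewrite ge0_fin_numE// measure_ge0.
rewrite [leRHS]integral_mkcond; apply: ge0_le_integral => //.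
- exact: measurable_ball_slice.
- by apply/(measurable_restrictT _ _).1 => //.
move=> x _; rewrite patchE; case: ifPn.
  move=> _; apply: le_measure; rewrite ?inE.
  - by apply: measurable_bool_set; mbool.
  - by apply: measurable_bool_set; mbool.
  move=> y /=; move=> /lt_le_trans; apply.
  by rewrite gerBl sqr_ge0.
rewrite notin_setE/= in_itv/= => /negP xN.
rewrite (_ : [set y | _] = set0) ?measure0//.
apply/seteqP; split => // y /=; apply/negP; rewrite -leNgt.
apply: le_trans (sqnorm_ge0 y).
rewrite leNgt; apply: contra xN; rewrite subr_gt0 => x1.
by apply/andP; split; nra.
Qed.

End ball_ratio.

Section cone.
Context {R : realType}.
Local Notation leb := (@lebesgue_measure R).
Local Notation mu n := (power_measure leb n).
Local Notation RR := (measurableTypeR R).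
Local Notation om := unit_ball_volume.

Lemma integral_expr n (c : R) : 0 < c ->
  (\int[leb]_(z in `]0%R, c[) (z ^+ n)%:E = (c ^+ n.+1 / n.+1%:R)%:E)%E.
Proof.
move=> c0; rewrite -(@integral_itv_bndoo _ _ _ _ true false); last first.
  by apply: measurable_funTS; apply/measurable_EFinP; exact: exprn_measurable.
pose F (x : R) : R := n.+1%:R^-1 *: (x ^+ n.+1 : R).
have dF (x : R) : is_derive x 1 F (x ^+ n).
  have dX : is_derive x 1 (fun x : R => x ^+ n.+1) (n.+1%:R *: x ^+ n).
    apply: DeriveDef; first exact: exprn_derivable.
    by rewrite -derive1E exp_derive1.
  apply: is_derive_eq (is_deriveZ n.+1%:R^-1 dX) _.
  by rewrite /GRing.scale/=; field.
have cF : continuous F.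
  move=> x; apply/differentiable_continuous/derivable1_diffP.
  by have [] := dF x.
rewrite (@continuous_FTC2 _ _ F)//.
- by rewrite /F expr0n/= scaler0 sube0 /GRing.scale/= mulrC.
- by apply: continuous_in_subspaceT => x _; exact: exprn_continuous.
- split.
  + by move=> x _; have [] := dF x.
  + by apply: cvg_at_right_filter; exact: cF.
  + by apply: cvg_at_left_filter; exact: cF.
- by move=> x _; rewrite derive1E; have [_] := dF x.
Qed.

(* The unit circle lies below its tangent at [(c, s)]. *)
Lemma tangent_bound (s c rho : R) : 0 < s -> 0 < c -> s ^+ 2 + c ^+ 2 = 1 ->
  1 - rho ^+ 2 <= (s + c / s * (c - rho)) ^+ 2.
Proof.
move=> s0 c0 sc.
have -> : (s + c / s * (c - rho)) ^+ 2 =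
    s ^+ 2 + 2 * c * (c - rho) + (c / s * (c - rho)) ^+ 2 by field; lra.
have := sqr_ge0 (c / s * (c - rho)); have := sqr_ge0 (c - rho); nra.
Qed.

(** At distance [rho = sqrt q] from the axis, [|x|] lies between the side of the cone, [rho s / c],
    and the tangent bound on the sphere. The tangent makes the width linear in [rho], namely
    [(c - rho) / (s c)] on each of the two sides. *)
Lemma cone_slice (s c q : R) : 0 < s -> 0 < c -> s ^+ 2 + c ^+ 2 = 1 -> 0 <= q ->
  (leb [set x | ((s ^+ 2 * (x ^+ 2 + q) < x ^+ 2) && (x ^+ 2 + q < 1))%R] <=
   (2 / (s * c))%:E * leb `]Num.sqrt q, c[%classic)%E.
Proof.
move=> s0 c0 sc q0; pose rho := Num.sqrt q.
have rho0 : 0 <= rho by exact: sqrtr_ge0.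
have rho2 : rho ^+ 2 = q by rewrite sqr_sqrtr.
have sNc : s ^+ 2 = 1 - c ^+ 2 by lra.
rewrite lebesgue_measure_itv/= lte_fin -/rho -EFinB; case: ltP => [rc|cr].
  pose al := rho * s / c; pose be := s + c / s * (c - rho).
  have al0 : 0 <= al by rewrite mulr_ge0 ?invr_ge0 ?mulr_ge0// ltW.
  have be0 : 0 < be.
    by rewrite ltr_pwDl// mulr_ge0 ?divr_ge0 ?subr_ge0// ltW.
  have albe : be - al = (c - rho) / (s * c).
    transitivity ((s ^+ 2 + c ^+ 2) * (c - rho) / (s * c)); last by rewrite sc mul1r.
    by rewrite /be /al; field; rewrite !gt_eqF.
  have albe0 : al < be.
    by rewrite -subr_gt0 albe divr_gt0 ?mulr_gt0 ?subr_gt0.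
  apply: (@le_trans _ _ (leb (`]al, be[ `|` `]-be, -al[)%classic)).
    apply: le_measure; rewrite ?inE.
    - by apply: measurable_bool_set; mbool.
    - exact: measurableU.
    move=> x /= /andP[h1 h2].
    have xal : al < `|x|.
      rewrite -(@ltr_pXn2r _ 2)// ?nnegrE// real_normK ?num_real//.
      rewrite expr_div_n exprMn rho2 ltr_pdivrMr ?exprn_gt0//; nra.
    have xbe : `|x| < be.
      rewrite -(@ltr_pXn2r _ 2)// ?nnegrE// ?(ltW be0)//.
      rewrite real_normK ?num_real//.
      have := tangent_bound rho s0 c0 sc; rewrite -/be rho2; lra.
    rewrite !in_itv/=; have [x0|x0] := leP 0 x.
      by left; move: xal xbe; rewrite ger0_norm// => -> ->.
    by right; move: xal xbe; rewrite ltr0_norm// ltrNl => + ?; lra.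
  apply: le_trans (measureU2 _ _ _) _ => //.
  rewrite /= !lebesgue_measure_itv/= !lte_fin albe0 ltrN2 albe0 -!EFinB -EFinD -EFinM.
  rewrite lee_fin opprK (addrC (- al)) albe.
  by rewrite le_eqVlt; apply/orP; left; apply/eqP; field; rewrite !gt_eqF.
(* For [rho >= c] the slice is empty: the two inequalities force [q < c ^+ 2]. *)
rewrite (_ : [set x | _] = set0) ?measure0 ?mule0//.
apply/seteqP; split => // x /= /andP[h1 h2].
have : c ^+ 2 <= q by rewrite -rho2 ler_pXn2r ?nnegrE// ltW.
nra.
Qed.

(** Parallel to the axis, each slice has length at most [2 / (s c)] times that of []|y|, c[].
    Exchanging the integrals again turns these intervals into balls of radius [z < c], so that the
    integral of [z ^+ n] remains. *)
Lemma cone_volume n (s c : R) : 0 < s -> 0 < c -> s ^+ 2 + c ^+ 2 = 1 ->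
  (\int[leb]_x \int[mu n]_y ((s ^+ 2 * (x ^+ 2 + sqnorm y) < x ^+ 2) &&
      (x ^+ 2 + sqnorm y < 1))%R%:R%:E <=
   (2 * c ^+ n / (s * n.+1%:R))%:E * om n)%E.
Proof.
move=> s0 c0 sc.
pose f (p : RR * rvec R n) : \bar R :=
  ((s ^+ 2 * (p.1 ^+ 2 + sqnorm p.2) < p.1 ^+ 2) &&
      (p.1 ^+ 2 + sqnorm p.2 < 1))%R%:R%:E.
have mf : measurable_fun setT f by rewrite /f; mbool.
have f0 p : (0 <= f p)%E by rewrite lee_fin.
rewrite (fubini_tonelli f)//.
pose g (p : RR * rvec R n) : \bar R :=
  ((0 < p.1) && (sqnorm p.2 < p.1 ^+ 2) && (p.1 < c))%R%:R%:E.
have mg : measurable_fun setT g by rewrite /g; mbool.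
have g0 p : (0 <= g p)%E by rewrite lee_fin.
have K0 : 0 <= 2 / (s * c) by rewrite divr_ge0// mulr_ge0// ltW.
apply: (@le_trans _ _ (\int[mu n]_y ((2 / (s * c))%:E * \int[leb]_z g (z, y)))%E).
  apply: ge0_le_integral => //.
  - by move=> y _; exact: integral_ge0.
  - exact: measurable_fun_fubini_tonelli_G.
  - by apply: measurable_funeM; exact: measurable_fun_fubini_tonelli_G.
  move=> y _; rewrite /f /g/= !integral_bool; [|by mbool..].
  apply: le_trans (cone_slice s0 c0 sc (sqnorm_ge0 y)) _.
  apply: lee_wpmul2l; first by rewrite lee_fin.
  apply: le_measure; rewrite ?inE//; first by apply: measurable_bool_set; mbool.
  move=> z; rewrite /= in_itv/= => /andP[z1 ->]; rewrite andbT.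
  have z0 : 0 < z by apply: le_lt_trans z1; exact: sqrtr_ge0.
  rewrite z0/= -(sqr_sqrtr (sqnorm_ge0 y)) ltr_pXn2r// nnegrE ?sqrtr_ge0//.
  exact: ltW.
rewrite ge0_integralZl_EFin//; last 2 first.
- by move=> y _; exact: integral_ge0.
- exact: measurable_fun_fubini_tonelli_G.
rewrite -(fubini_tonelli g)//.
suff -> : (\int[leb]_z \int[mu n]_y g (z, y) = (c ^+ n.+1 / n.+1%:R)%:E * om n)%E.
  rewrite muleA -EFinM; apply: lee_wpmul2r; first exact: measure_ge0.
  rewrite lee_fin le_eqVlt; apply/orP; left; apply/eqP.
  by rewrite exprS; field; rewrite !gt_eqF ?ltr0Sn.
rewrite -integral_expr// -ge0_integralZr//; last 2 first.
- by apply: measurable_funTS; apply/measurable_EFinP; exact: exprn_measurable.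
- by move=> z /=; rewrite in_itv/= lee_fin => /andP[z0 _]; rewrite exprn_ge0// ltW.
rewrite [RHS]integral_mkcond; apply: eq_integral => z _.
rewrite patchE mem_setE in_itv/= /g /=.
have [z0|z0] /= := ltP 0 z; last by rewrite integral0.
have [zc|zc] /= := ltP z c.
  under eq_integral do rewrite andbT.
  by rewrite integral_bool; [exact: measure_ball|mbool].
by under eq_integral do rewrite andbF; rewrite integral0.
Qed.

End cone.

(** * Spherical laws *)

Section homogeneous.
Local Open Scope ereal_scope.
Context d (T : measurableType d) (R : realType).
Context (m : {measure set T -> \bar R}).
Local Notation RR := (measurableTypeR R).

Lemma ge0_integral_mrestr (A : set T) (mA : measurable A) (f : T -> \bar R) :
  measurable_fun setT f -> (forall x, 0 <= f x) ->
  \int[mrestr m mA]_x f x = \int[m]_(x in A) f x.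
Proof.
move=> mf f0.
rewrite (@ge0_negligible_integral _ _ _ _ setT (~` A))//; last 2 first.
- exact: measurableC.
- by rewrite /= /mrestr setICl measure0.
rewrite setTD setCK; apply: eq_measure_integral => B mB BA.
by rewrite /= /mrestr setIidl.
Qed.

(* Two measures on the line proportional on all half-lines [`]-oo, r[]
   integrate every function of [q] proportionally. *)
Lemma integral_homogeneous (q : T -> RR) (A : set T) (h : R -> R)
    (k : RR -> \bar R) :
  measurable_fun setT q -> (forall x, (0 <= q x)%R) -> measurable A ->
  m [set x | (q x < 1)%R] < +oo ->
  (forall r, (0 < r)%R -> (0 <= h r)%R) ->
  (forall r, (0 < r)%R ->
    m [set x | (q x < r)%R] = (h r)%:E * m [set x | (q x < 1)%R]) ->
  (forall r, (0 < r)%R ->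
    m (A `&` [set x | (q x < r)%R]) =
      (h r)%:E * m (A `&` [set x | (q x < 1)%R])) ->
  measurable_fun setT k -> (forall x, 0 <= k x) ->
  m [set x | (q x < 1)%R] * \int[m]_(x in A) k (q x) =
  m (A `&` [set x | (q x < 1)%R]) * \int[m]_x k (q x).
Proof.
move=> mq q0 mA b_lty h0 hT hA mk k0.
have mqr r : measurable [set x | (q x < r)%R].
  by apply: measurable_bool_set; mbool.
set b := m [set x | _] in b_lty *; set a := m (A `&` _).
have b_fin : b \is a fin_num by rewrite ge0_fin_numE// measure_ge0.
have a_fin : a \is a fin_num.
  rewrite ge0_fin_numE ?measure_ge0//; apply: le_lt_trans b_lty.
  by apply: le_measure; rewrite ?inE//; exact: measurableI.
have b0 : (0 <= fine b)%R by rewrite fine_ge0// measure_ge0.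
have a0 : (0 <= fine a)%R by rewrite fine_ge0// measure_ge0.
pose m1_ : {measure set RR -> \bar R} :=
  mscale (NngNum b0) (pushforward (mrestr m mA) q).
pose m2_ : {measure set RR -> \bar R} := mscale (NngNum a0) (pushforward m q).
pose m1 := m1_ mq; pose m2 := m2_ mq.
have m12 B : measurable B -> m1 B = m2 B.
  have unique := @measure_unique _ R RR (@RGenInftyO.G R)
    (fun k => `]-oo, k%:R%R[%classic) (@RGenInftyO.measurableE R).
  apply: (unique _ _ _ m1 m2 _ _ B).
  - move=> _ _ [x ->] [y ->]; exists (Num.min x y).
    by apply/seteqP; split => z /=; rewrite !in_itv/= lt_min => /andP.
  - by move=> i; exists i%:R%R.
  - apply/seteqP; split => // x _; exists (Num.truncn `|x|).+1 => //=.
    rewrite in_itv/=; apply: le_lt_trans (ler_norm x) _.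
    exact: truncnS_gt.
  - move=> _ [r ->]; rewrite /m1 /m2 /= /mscale/= /pushforward /mrestr.
    have -> : q @^-1` `]-oo, r[ = [set x | (q x < r)%R].
      by apply/seteqP; split => x /=; rewrite in_itv.
    have [r0|r0] := ltP 0%R r.
      rewrite setIC hT// hA// !fineK// -/a -/b.
      by rewrite [LHS]muleCA [RHS]muleCA [X in _ = _ * X]muleC.
    rewrite (_ : [set x | _] = set0) ?set0I ?measure0 ?mule0//.
    apply/seteqP; split => // x /=; apply/negP; rewrite -leNgt.
    exact: le_trans (q0 x).
  - move=> i; rewrite /m1 /= /mscale/= /pushforward /mrestr.
    have -> : q @^-1` `]-oo, i%:R%R[ = [set x | (q x < i%:R)%R].
      by apply/seteqP; split => x /=; rewrite in_itv.
    apply: lte_mul_pinfty; rewrite ?lee_fin//.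
    (* The radius is raised to [i.+1] because the scaling hypothesis needs a positive radius and [i]
       may be 0. *)
    apply: (@le_lt_trans _ _ (m [set x | (q x < i.+1%:R)%R])).
      apply: le_measure; rewrite ?inE//; first exact: measurableI.
      by move=> x [/= + _] => /lt_le_trans; apply; rewrite ler_nat.
    by rewrite hT// -/b lte_mul_pinfty ?lee_fin ?h0.
have [Ek Et] : \int[m1]_x k x = b * \int[m]_(x in A) k (q x) /\
    \int[m2]_x k x = a * \int[m]_x k (q x).
  rewrite /m1 /m2 !ge0_integral_mscale//= !fineK//.
  rewrite (@ge0_integral_pushforward _ _ _ _ _ q mq)//=.
  rewrite (@ge0_integral_pushforward _ _ _ _ _ q mq)//=.
  by rewrite preimage_setT ge0_integral_mrestr//; exact: measurableT_comp.
by rewrite -Ek -Et; apply: eq_measure_integral => B mB _; exact: m12.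
Qed.

End homogeneous.

Section cap.
Context {R : realType}.
Local Notation leb := (@lebesgue_measure R).
Local Notation mu n := (power_measure leb n).
Local Notation RR := (measurableTypeR R).
Local Notation om := unit_ball_volume.

Definition double_cone n (l : 'I_n -> R) (s : R) : set (rvec R n) :=
  [set x | s ^+ 2 * sqnorm x < dot l x ^+ 2].

Definition cap_bound d (s : R) : R :=
  Num.sqrt 8 * Num.sqrt (1 - s ^+ 2) ^+ d.-1 / (s * Num.sqrt d%:R).

Let in_cone (s r : R) (p : RR * RR) : \bar R :=
  ((s ^+ 2 * p.2 < p.1 ^+ 2) && (p.2 < r))%R%:R%:E.

Let measurable_in_cone s r : measurable_fun setT (in_cone s r).
Proof. by rewrite /in_cone; mbool. Qed.

Let in_cone_ge0 s r p : (0 <= in_cone s r p)%E.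
Proof. by rewrite lee_fin. Qed.

(** The volume of the cone about [e_0] cut by [sqnorm x < r], already sliced; rotation invariance
    gives this value for every unit axis. *)
Let cone_sector n s r : \bar R :=
  (\int[leb]_x \int[mu n]_y in_cone s r (x, x ^+ 2 + sqnorm y)%R)%E.

Lemma measurable_double_cone n (l : 'I_n -> R) s : measurable (double_cone l s).
Proof. by apply: measurable_bool_set; mbool. Qed.

Let measure_sector n (l : 'I_n.+1 -> R) s r : \sum_i l i ^+ 2 = 1 ->
  mu n.+1 (double_cone l s `&` [set x | (sqnorm x < r)%R]) = cone_sector n s r.
Proof.
move=> l1.
rewrite (_ : _ `&` _ = [set x | (s ^+ 2 * sqnorm x < dot l x ^+ 2) && (sqnorm x < r)]).
  rewrite -integral_bool; last by mbool.
  exact: (@integral_rotation _ n l (in_cone s r)).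
by apply/seteqP; split => x /= /andP.
Qed.

(** The cone is invariant under dilation: [n] factors [r] come from the transverse coordinates and
    one from the axis. *)
Let cone_sector_scale n s r : 0 < r ->
  cone_sector n s (r ^+ 2) = ((r ^+ n.+1)%:E * cone_sector n s 1)%E.
Proof.
move=> r0; have rn0 : r != 0 by rewrite gt_eqF.
pose G (x : RR) : \bar R :=
  (\int[mu n]_y in_cone s 1 (x, x ^+ 2 + sqnorm y)%R)%E.
have mG : measurable_fun setT G.
  apply: (@measurable_integral_param _ _ _ _ _ _ _
    (fun (x : RR) y => in_cone s 1 (x, x ^+ 2 + sqnorm y)%R)) => //.
  by rewrite /in_cone/=; mbool.
have G0 x : (0 <= G x)%E by apply: integral_ge0.
have -> : cone_sector n s 1 = (\int[leb]_x G x)%E by [].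
rewrite [r ^+ n.+1]exprSr EFinM -muleA.
have -> : (r%:E * \int[leb]_x G x = \int[leb]_x G (r^-1 * x + 0)%R)%E.
  rewrite (@integral_affine _ G r^-1 0); [|by rewrite invr_eq0|exact: mG|exact: G0].
  by rewrite gtr0_norm ?invr_gt0// invrK.
rewrite -ge0_integralZl_EFin//; last 2 first.
- apply: (measurableT_comp mG); mfun.
- by rewrite exprn_ge0// ltW.
apply: eq_integral => x _; rewrite addr0 /G.
have -> : ((r ^+ n)%:E = ((r^-1)^-1 ^+ n)%:E :> \bar R) by rewrite invrK.
rewrite -(@integral_sqnorm_scale _ n
  (fun q => in_cone s 1 (r^-1 * x, (r^-1 * x) ^+ 2 + q)%R)) ?invr_gt0//; last first.
  by rewrite /in_cone/=; mbool.
apply: eq_integral => y _; rewrite /in_cone/=.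
have -> : (r^-1 * x) ^+ 2 + r^-1 ^+ 2 * sqnorm y =
  r^-1 ^+ 2 * (x ^+ 2 + sqnorm y) by rewrite exprMn mulrDr.
congr (_%:R%:E); rewrite exprMn [s ^+ 2 * (_ * _)]mulrCA ltr_pM2l; last first.
  by rewrite exprn_gt0// invr_gt0.
congr (_ && _).
by rewrite exprVn mulrC ltr_pdivrMr ?exprn_gt0// mul1r.
Qed.

(** [cone_volume] is stated with the ball of dimension [n]; passing to dimension [n.+1] costs
    [sqrt (2 (n + 1))], and [2 * sqrt 2] is the [sqrt 8] of [cap_bound]. *)
Let cone_sector_le n s : 0 < s < 1 ->
  (cone_sector n s 1 <= (cap_bound n.+1 s)%:E * om n.+1)%E.
Proof.
move=> /andP[s0 s1]; pose c := Num.sqrt (1 - s ^+ 2).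
have s21 : s ^+ 2 < 1 by rewrite expr_lt1// ltW.
have c0 : 0 < c by rewrite sqrtr_gt0 subr_gt0.
have sc : s ^+ 2 + c ^+ 2 = 1 by rewrite sqr_sqrtr ?subr_ge0 ?ltW// addrC subrK.
apply: le_trans (cone_volume n s0 c0 sc) _.
have K0 : 0 <= 2 * c ^+ n / (s * n.+1%:R).
  by rewrite divr_ge0 ?mulr_ge0 ?exprn_ge0// ltW.
apply: le_trans.
  by apply: (lee_wpmul2l _ (unit_ball_volume_leS n)); rewrite lee_fin.
rewrite muleA -EFinM; apply: lee_wpmul2r; first exact: measure_ge0.
rewrite lee_fin /cap_bound -/c /=.
have n0 : 0 < n.+1%:R :> R by [].
have w0 : Num.sqrt n.+1%:R != 0 :> R by rewrite gt_eqF// sqrtr_gt0.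
have wE : n.+1%:R = Num.sqrt n.+1%:R * Num.sqrt n.+1%:R :> R.
  by rewrite -expr2 sqr_sqrtr// ltW.
have -> : Num.sqrt 8 = 2 * Num.sqrt 2 :> R.
  have -> : 8 = 2 ^+ 2 * 2 :> R by ring.
  by rewrite sqrtrM ?sqr_ge0// sqrtr_sqr ger0_norm.
rewrite sqrtrM// {1}wE le_eqVlt; apply/orP; left; apply/eqP.
by field; rewrite w0 gt_eqF.
Qed.

(* The radial density cancels: the cone meets all balls in the same proportion. *)
Lemma spherical_cap n (m : set (rvec R n.+1) -> \bar R) (k : RR -> \bar R)
    (l : 'I_n.+1 -> R) (s : R) :
  measurable_fun setT k -> (forall x, 0 <= k x)%E ->
  (forall A, measurable A -> m A = \int[mu n.+1]_(x in A) k (sqnorm x))%E ->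
  m setT = 1%E -> \sum_i l i ^+ 2 = 1 -> 0 < s < 1 ->
  (m (double_cone l s) <= (cap_bound n.+1 s)%:E)%E.
Proof.
move=> mk k0 mE mT l1 s01.
have mC := measurable_double_cone l s.
have sq r : 0 < r -> exists2 t, 0 < t & r = t ^+ 2 /\ Num.sqrt r = t.
  move=> r0; exists (Num.sqrt r); first by rewrite sqrtr_gt0.
  by rewrite sqr_sqrtr// ltW.
(* The set [sqnorm x < r] is a ball of radius [sqrt r], hence the scaling factor
   [Num.sqrt r ^+ n.+1]. *)
have E : (om n.+1 * m (double_cone l s) = cone_sector n s 1)%E.
  rewrite -(measure_sector s 1 l1) -[RHS]mule1 -mT (mE _ mC) (mE _ measurableT).
  apply: (@integral_homogeneous _ _ _ (mu n.+1) (@sqnorm R n.+1) _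
    (fun r => Num.sqrt r ^+ n.+1)) => //.
  - exact: measurable_sqnorm.
  - exact: sqnorm_ge0.
  - exact: unit_ball_volume_lty.
  - by move=> _ /sq[t t0 [-> /= ->]]; exact: measure_ball.
  - move=> _ /sq[t t0 [-> /= ->]]; rewrite !measure_sector//.
    exact: cone_sector_scale.
have om0 := @unit_ball_volume_gt0 R n.+1.
have := cone_sector_le n s01; rewrite -E muleC.
by rewrite lee_pmul2r// ge0_fin_numE ?unit_ball_volume_lty// ltW.
Qed.

End cap.

(** * Gaussian vectors *)

Section gaussian.
Context {R : realType}.
Local Notation leb := (@lebesgue_measure R).
Local Notation mu n := (power_measure leb n).
Local Notation gamma := (normal_prob (0 : R) 1).
Local Notation gam n := (power_measure gamma n).
Local Notation RR := (measurableTypeR R).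

(** The Radon-Nikodym derivative and [normal_pdf] have the same integral over every measurable set,
    so they agree almost everywhere. *)
Lemma integral_normal_prob (f : RR -> \bar R) :
  measurable_fun setT f -> (forall x, 0 <= f x)%E ->
  (\int[gamma]_x f x = \int[leb]_x (f x * (normal_pdf 0 1 x)%:E))%E.
Proof.
move=> mf f0.
have dom := @normal_prob_dominates R 0 1.
rewrite -(Radon_Nikodym_SigmaFinite.change_of_variables dom f0)//.
have mRN := Radon_Nikodym_SigmaFinite.f_integrable dom.
apply: ae_eq_integral => //.
- by apply: emeasurable_funM => //; exact: measurable_int mRN.
- apply: emeasurable_funM => //; apply/measurable_EFinP.
  exact: measurable_normal_pdf.
apply: ae_eqe_mul2l; apply: integral_ae_eq => //.
- apply/measurable_EFinP; exact: measurable_normal_pdf.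
- by move=> E _ mE; rewrite -Radon_Nikodym_SigmaFinite.f_integral.
Qed.

(** The standard Gaussian density as a function of the squared norm [q], the radial form that
    [spherical_law] asks for. *)
Definition gaussian_density n (q : RR) : R :=
  normal_peak 1 ^+ n * expR (- (q / 2)).

Lemma measurable_gaussian_density n : measurable_fun setT (@gaussian_density n).
Proof.
apply: measurable_funM => //; apply: measurableT_comp => //.
by apply: measurableT_comp => //; apply: measurable_funM.
Qed.

Lemma gaussian_density_ge0 n q : 0 <= gaussian_density n q.
Proof. by rewrite mulr_ge0 ?expR_ge0// exprn_ge0// normal_peak_ge0. Qed.

Lemma integral_gaussian n (f : rvec R n -> \bar R) :
  measurable_fun setT f -> (forall x, 0 <= f x)%E ->
  (\int[gam n]_x f x =
   \int[mu n]_x (f x * (gaussian_density n (sqnorm x))%:E))%E.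
Proof.
elim: n f => [|n IH] f mf f0.
  apply: eq_integral => x _.
  rewrite /gaussian_density /sqnorm big_ord0 mul0r oppr0 expR0 mulr1 expr0.
  by rewrite mule1.
have mg m : measurable_fun setT
    (fun x : rvec R m => (gaussian_density m (sqnorm x))%:E).
  apply/measurable_EFinP.
  apply: (measurableT_comp (@measurable_gaussian_density m)).
  exact: measurable_sqnorm.
rewrite !integral_powerS//; last 2 first.
- by apply: emeasurable_funM => //; exact: mg.
- by move=> x; rewrite mule_ge0// lee_fin gaussian_density_ge0.
have mc : measurable_fun setT
    (fun p : RR * rvec R n => [tuple of p.1 :: p.2] : rvec R n.+1).
  exact: measurable_cons.
have mfx x : measurable_fun setT (fun y : rvec R n => f [tuple of x :: y]).
  by apply: measurableT_comp => //; exact: measurable_cons.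
rewrite integral_normal_prob; last 2 first.
- apply: (@measurable_integral_param _ _ _ _ _ _ _
    (fun (x : RR) y => f [tuple of x :: y])) => //.
  exact: (measurableT_comp mf mc).
- by move=> x; exact: integral_ge0.
apply: eq_integral => x _.
rewrite IH// -ge0_integralZr//; last 3 first.
- by apply: emeasurable_funM => //; exact: mg.
- by move=> y _; rewrite mule_ge0// lee_fin gaussian_density_ge0.
- by rewrite lee_fin normal_pdf_ge0.
apply: eq_integral => y _; rewrite -muleA -EFinM; congr (_ * _%:E)%E.
rewrite normal_pdfE// /normal_fun /gaussian_density sqnorm_cons subr0.
rewrite mulrACA -exprSr -expRD; congr (_ * expR _).
by rewrite expr1n; field.
Qed.

Lemma gaussian_measureE n (A : set (rvec R n)) : measurable A ->
  gam n A = (\int[mu n]_(x in A) (gaussian_density n (sqnorm x))%:E)%E.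
Proof.
move=> mA; transitivity (\int[gam n]_x (\1_A x : R)%:E)%E.
  by rewrite integral_indic// setIT.
rewrite integral_gaussian//; last first.
  by apply/measurable_EFinP; exact: measurable_indic.
rewrite [RHS]integral_mkcond; apply: eq_integral => x _.
rewrite patchE indicE; case: (x \in A); first by rewrite mul1e.
by rewrite mul0e.
Qed.

Lemma gaussian_setT n : gam n setT = 1%E.
Proof.
elim: n => [|n IH]; first by rewrite /= diracT.
rewrite -[LHS]mul1e -integral_cst// integral_powerS//.
transitivity (\int[gamma]_x (cst 1 x))%E.
  by apply: eq_integral => x _; rewrite integral_cst// mul1e; exact: IH.
by rewrite integral_cst// mul1e; exact: probability_setT.
Qed.

(** The factor [expR (la * x ^+ 2)] turns the standard density into [si] times the centered normal
    density of standard deviation [si = (1 - 2 la)^(-1/2)]. *)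
Lemma integral_normal_expR_sqr (la : R) : la < 2^-1 ->
  (\int[gamma]_x (expR (la * x ^+ 2))%:E = (Num.sqrt (1 - 2 * la))^-1%:E)%E.
Proof.
move=> la2; have la1 : 0 < 1 - 2 * la by lra.
rewrite integral_normal_prob; last 2 first.
- apply/measurable_EFinP; apply: measurableT_comp => //; mfun.
- by move=> x; rewrite lee_fin expR_ge0.
pose si := (Num.sqrt (1 - 2 * la))^-1.
have si0 : 0 < si by rewrite invr_gt0 sqrtr_gt0.
have siN0 : si != 0 by rewrite gt_eqF.
have si2 : si ^+ 2 = (1 - 2 * la)^-1 by rewrite exprVn sqr_sqrtr// ltW.
rewrite -[RHS]mule1 -(integral_normal_pdf (0 : R) si) -ge0_integralZl_EFin; last 4 first.
- exact: measurableT.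
- by move=> x _; rewrite lee_fin normal_pdf_ge0.
- by apply/measurable_EFinP; exact: measurable_normal_pdf.
- exact: ltW.
apply: eq_integral => x _; rewrite -!EFinM; congr EFin.
rewrite !normal_pdfE//.
have -> : normal_peak 1 = si * normal_peak si.
  rewrite /normal_peak expr1n mul1r -mulrnAr sqrtrM ?sqr_ge0// sqrtr_sqr.
  by rewrite gtr0_norm// invfM mulrA divff// mul1r.
rewrite mulrCA -mulrA; congr (_ * (_ * _)).
rewrite -expRD; congr expR; rewrite si2 expr1n subr0; field.
by rewrite gt_eqF.
Qed.

Lemma integral_gaussian_expR n (la : R) : la < 2^-1 ->
  (\int[gam n]_x (expR (la * sqnorm x))%:E =
   ((Num.sqrt (1 - 2 * la))^-1 ^+ n)%:E)%E.
Proof.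
move=> la2; have me m : measurable_fun setT
    (fun x : rvec R m => (expR (la * sqnorm x))%:E).
  by apply/measurable_EFinP; apply: measurableT_comp => //; mfun.
have e0 m (x : rvec R m) : (0 <= (expR (la * sqnorm x))%:E)%E.
  by rewrite lee_fin expR_ge0.
have mx : measurable_fun setT (fun x : RR => (expR (la * x ^+ 2))%:E).
  by apply/measurable_EFinP; apply: measurableT_comp => //; mfun.
elim: n => [|n IH].
  rewrite /= integral_dirac//; last exact: (me 0).
  by rewrite diracE mem_set// mul1e /sqnorm big_ord0 mulr0 expR0 expr0.
rewrite integral_powerS//.
transitivity (\int[gamma]_x ((expR (la * x ^+ 2))%:E *
    ((Num.sqrt (1 - 2 * la))^-1 ^+ n)%:E))%E.
  apply: eq_integral => x _; rewrite -IH -ge0_integralZl//; last exact: me.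
  by apply: eq_integral => y _; rewrite sqnorm_cons mulrDr expRD EFinM.
rewrite ge0_integralZr//.
by rewrite integral_normal_expR_sqr// -EFinM exprS.
Qed.

(** Chernoff bound with [la = 1 / (4 sqrt d)], where [d = n.+1]. The moment generating function is
    at most [expR (d (la + 4 la^2))]; the term [d la] cancels against the mean and
    [4 d la^2 = 1/4]. *)
Lemma gaussian_tail n (b : R) :
  (gam n.+1 [set x | (n.+1%:R + b < sqnorm x)%R] <=
   (expR (4^-1 - b / (4 * Num.sqrt n.+1%:R)))%:E)%E.
Proof.
set w := Num.sqrt n.+1%:R; pose la := (4 * w)^-1.
have w1 : 1 <= w by rewrite -sqrtr1 ler_wsqrtr// ler1n.
have w2 : w ^+ 2 = n.+1%:R by rewrite sqr_sqrtr.
have la0 : 0 < la by rewrite invr_gt0; lra.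
have la4 : la <= 4^-1 by rewrite lef_pV2 ?posrE; lra.
have la2 : la < 2^-1 by lra.
have me : measurable_fun setT
    (fun x : rvec R n.+1 => (expR (la * sqnorm x))%:E).
  by apply/measurable_EFinP; apply: measurableT_comp => //; mfun.
pose K := expR (- (la * (n.+1%:R + b))).
apply: (@le_trans _ _ (\int[gam n.+1]_x (K%:E * (expR (la * sqnorm x))%:E))%E).
  rewrite -integral_bool; last by mbool.
  apply: ge0_le_integral => //.
  - by mbool.
  - exact: measurable_funeM.
  move=> x _; rewrite -EFinM lee_fin -expRD.
  case: ltP => /= [h|_]; last by rewrite expR_ge0.
  rewrite -[leLHS]expR0 ler_expR addrC subr_ge0 ler_pM2l//; exact: ltW.
rewrite ge0_integralZl_EFin ?expR_ge0//.
rewrite integral_gaussian_expR// -EFinM lee_fin.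
have la1 : 0 < 1 - 2 * la by lra.
(* Use [1 / (1 - 2 la) = 1 + 2 la / (1 - 2 la) <= expR (2 la / (1 - 2 la))]; this exponent is at
   most [2 (la + 4 la^2)] because [la <= 1/4]. *)
have si_le : (Num.sqrt (1 - 2 * la))^-1 <= expR (la + 4 * la ^+ 2).
  have <- : Num.sqrt (expR (la + 4 * la ^+ 2) ^+ 2) = expR (la + 4 * la ^+ 2).
    by rewrite sqrtr_sqr ger0_norm ?expR_ge0.
  rewrite -sqrtrV; last exact: ltW.
  apply: ler_wsqrtr; rewrite -expRM_natl.
  apply: (@le_trans _ _ (expR (2 * la / (1 - 2 * la)))).
    apply: le_trans (expR_ge1Dx _); rewrite le_eqVlt; apply/orP; left; apply/eqP.
    by field; rewrite gt_eqF.
  rewrite ler_expR ler_pdivrMr//.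
  have : 0 <= la ^+ 2 * (1 - 4 * la) by rewrite mulr_ge0 ?sqr_ge0//; lra.
  nra.
have K0 : 0 <= K by exact: expR_ge0.
apply: (@le_trans _ _ (K * expR (la + 4 * la ^+ 2) ^+ n.+1)).
  apply: ler_wpM2l => //; apply: lerXn2r; [| |exact: si_le]; rewrite nnegrE.
    by rewrite invr_ge0 sqrtr_ge0.
  exact: expR_ge0.
rewrite -expRM_natl -expRD ler_expR le_eqVlt; apply/orP; left; apply/eqP.
rewrite /la -w2; field; lra.
Qed.

End gaussian.

(** * The supremum norm *)

Section supnorm.
Context {R : realType}.

Lemma measurable_supnorm n : measurable_fun setT (@supnorm R n).
Proof.
rewrite /supnorm; elim: (index_enum _) => [|i s IH].
  under eq_fun do rewrite big_nil.
  exact: measurable_cst.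
under eq_fun do rewrite big_cons.
apply: measurable_maxr => //; apply: measurableT_comp => //.
exact: measurable_tnth.
Qed.

Lemma measurable_mx_map m n (A : 'M[R]_(m, n)) : measurable_fun setT (mx_map A).
Proof.
apply/measurable_fun_tnthP => i.
rewrite (_ : _ \o _ = dot (A i)); first exact: measurable_dot.
apply/funext => x; rewrite /= tnth_mktuple mxE.
by apply: eq_bigr => j _; rewrite mxE.
Qed.

Lemma measure_bigU_le d (T : measurableType d) (m : {measure set T -> \bar R})
    (I : Type) (r : seq I) (A : I -> set T) (c : R) :
  (forall i, measurable (A i)) -> (forall i, m (A i) <= c%:E)%E ->
  (m (\big[setU/set0]_(i <- r) A i) <= ((size r)%:R * c)%:E)%E.
Proof.
move=> mA mc; elim: r => [|i r IH]; first by rewrite big_nil measure0 mul0r.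
rewrite big_cons; apply: le_trans (measureU2 _ _ _) _ => //.
  exact: bigsetU_measurable.
by rewrite /= -natr1 mulrDl mul1r addrC EFinD leeD.
Qed.

(** The columns of [L] are unit vectors because [S] has unit diagonal. If [|x| <= a] and some entry
    of [L^T x] exceeds [a s] in absolute value, then [x] lies in the double cone about that column;
    a union bound follows. *)
Lemma factor_supnorm_le d (T : measurableType d) (P : probability T R) k p
    (m : {measure set (rvec R k) -> \bar R}) (X : {RV P >-> rvec R p})
    (S : 'M[R]_p) (a s : R) :
  factor_law m X S -> (forall i, S i i = 1) -> 0 <= a -> 0 < s ->
  (forall l : 'I_k -> R, \sum_i l i ^+ 2 = 1 ->
    (m (double_cone l s) <= (cap_bound k s)%:E)%E) ->
  (P [set w | (a * s < supnorm (X w))%R] <=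
   m [set x | (a ^+ 2 < sqnorm x)%R] + (p%:R * cap_bound k s)%:E)%E.
Proof.
move=> [L SL law] S1 a0 s0 cap; pose l j i := L i j.
have l1 j : \sum_i l j i ^+ 2 = 1.
  rewrite -(S1 j) SL mxE; apply: eq_bigr => i _.
  by rewrite mxE expr2.
have mB : measurable [set x : rvec R p | (a * s < supnorm x)%R].
  apply: measurable_bool_set; apply: measurable_fun_ltr => //.
  exact: measurable_supnorm.
have mq : measurable [set x : rvec R k | (a ^+ 2 < sqnorm x)%R].
  by apply: measurable_bool_set; mbool.
have mU : measurable (\big[setU/set0]_(j <- index_enum 'I_p) double_cone (l j) s).
  by apply: bigsetU_measurable => j _; exact: measurable_double_cone.
have := law _ mB; rewrite /distribution /pushforward => PE.
apply: (@le_trans _ _ (m (mx_map L^T @^-1` [set x | (a * s < supnorm x)%R]))).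
  by rewrite -PE.
apply: (@le_trans _ _ (m ([set x | (a ^+ 2 < sqnorm x)%R] `|`
    \big[setU/set0]_(j <- index_enum 'I_p) double_cone (l j) s))).
  apply: le_measure; rewrite ?inE.
  - by rewrite -[X in measurable X]setTI; exact: measurable_mx_map.
  - exact: measurableU.
  move=> x /= asx; have [q_le|q_gt] := leP (sqnorm x) (a ^+ 2); last by left.
  right; rewrite -bigcup_seq/=.
  have [j] : exists j : 'I_p, a * s < `|tnth (mx_map L^T x) j|.
    apply/existsP; rewrite -[X in is_true X]negbK; apply/negP => /existsPn H.
    move: asx; rewrite ltNge => /negP; apply.
    apply: bigmax_le => [|j _]; first by rewrite mulr_ge0// ltW.
    by rewrite leNgt.
  move=> h; exists j; first by rewrite /= mem_index_enum.
  move: h; rewrite tnth_mktuple mxE.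
  rewrite (_ : \sum_i _ = dot (l j) x); last first.
    by apply: eq_bigr => i _; rewrite !mxE.
  move=> h; rewrite /double_cone/= -(real_normK (num_real (dot _ _))).
  apply: (@le_lt_trans _ _ ((a * s) ^+ 2)).
    by rewrite exprMn mulrC ler_wpM2r// sqr_ge0.
  by rewrite ltr_pXn2r ?nnegrE// mulr_ge0// ltW.
apply: le_trans (measureU2 _ _ _) _ => //.
apply: leeD => //.
have sp : size (index_enum 'I_p) = p.
  by rewrite -sum1_size big_const_ord iter_addn_0 mul1n.
have := @measure_bigU_le _ _ m _ (index_enum 'I_p) (fun j => double_cone (l j) s)
  (cap_bound k s); rewrite sp; apply => j.
  exact: measurable_double_cone.
exact: cap.
Qed.

End supnorm.

(** * Asymptotics *)

Section estimates.
Context {R : realType}.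
Implicit Types (ell x eps : R) (n p : nat).

(* The bound for a uniform point of the unit sphere instead of [Z]. *)
Definition threshold p n : R := rank_bound 1 p n.

Lemma rank_boundE (u : R) p n : 0 <= u ->
  rank_bound u p n = Num.sqrt u * threshold p n.
Proof. by move=> u0; rewrite /threshold /rank_bound sqrtrM// mul1r. Qed.

(** Dimensions are written [n.+2] so that [d - 1 = n.+1] is positive; [0 < p] keeps [powR] away from
    its special value at base 0. *)
Lemma thresholdE p n : (0 < p)%N ->
  threshold p n.+2 = Num.sqrt (1 - expR (- (2 * ln p%:R / n.+1%:R))).
Proof.
move=> p0; rewrite /threshold /rank_bound mul1r /powR pnatr_eq0 gtn_eqF//.
rewrite -[n.+2%:R]natr1 addrK; congr (Num.sqrt (1 - expR _)).
by rewrite !mulNr mulrAC.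
Qed.

Lemma sqr_radius_ge x : 0 <= x -> x / (1 + x) <= 1 - expR (- x).
Proof.
move=> x0; have x1 : 0 < 1 + x by lra.
have : expR (- x) <= (1 + x)^-1.
  by rewrite expRN lef_pV2 ?posrE ?expR_gt0//; exact: expR_ge1Dx.
suff -> : x / (1 + x) = 1 - (1 + x)^-1 by lra.
by field; rewrite gt_eqF.
Qed.

(** With [x = 2 ell / (d - 1)], [x / (1 + x) >= 2 ell / (d + 2 ell)], and the inverse of [d] times
    the right side is [1 / (2 ell) + 1 / d]. No relation between [ell] and [d] is assumed, as the
    joint limit demands. *)
Lemma radius_inv_le ell n : 0 < ell ->
  (Num.sqrt (1 - expR (- (2 * ell / n.+1%:R))) * Num.sqrt n.+2%:R)^-1 <=
  Num.sqrt ((2 * ell)^-1 + n.+2%:R^-1).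
Proof.
move=> ell0; set x := 2 * ell / n.+1%:R.
have n1 : 1 <= n.+1%:R :> R by rewrite ler1n.
have x0 : 0 < x by rewrite divr_gt0; lra.
have t0 : 0 < 1 - expR (- x) by rewrite subr_gt0 expR_lt1; lra.
rewrite -sqrtrM ?(ltW t0)// -sqrtrV; last by rewrite mulr_ge0// ltW.
apply: ler_wsqrtr.
have d0 : 0 < n.+2%:R :> R by [].
have -> : (2 * ell)^-1 + n.+2%:R^-1 = (2 * ell * n.+2%:R / (n.+2%:R + 2 * ell))^-1.
  by field; rewrite !gt_eqF//; lra.
rewrite lef_pV2 ?posrE ?mulr_gt0 ?invr_gt0//; try lra.
rewrite mulrAC ler_pM2r//.
apply: le_trans (sqr_radius_ge (ltW x0)).
have -> : x / (1 + x) = 2 * ell / (n.+1%:R + 2 * ell).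
  by rewrite /x; field; rewrite !gt_eqF//; lra.
apply: ler_wpM2l; first lra.
by rewrite -[n.+2%:R]natr1 lef_pV2 ?posrE; lra.
Qed.

Lemma threshold_gt0_lt1 p n : (1 < p)%N -> 0 < threshold p n.+2 < 1.
Proof.
move=> p1; rewrite thresholdE ?(ltnW p1)//.
have l0 : 0 < ln p%:R :> R by rewrite ln_gt0// ltr1n.
have x0 : 0 < 2 * ln p%:R / n.+1%:R :> R by rewrite divr_gt0 ?mulr_gt0.
have e0 := expR_gt0 (- (2 * ln p%:R / n.+1%:R) : R).
have e1 : expR (- (2 * ln p%:R / n.+1%:R)) < 1 :> R.
  by rewrite expR_lt1 oppr_lt0.
rewrite sqrtr_gt0 subr_gt0 e1/= -[ltRHS]sqrtr1 ltr_sqrt//; lra.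
Qed.

Lemma sqrt_expR x : Num.sqrt (expR x) = expR (x / 2).
Proof.
rewrite -[x in LHS](_ : 2%:R * (x / 2) = x); last by field.
by rewrite expRM_natl sqrtr_sqr ger0_norm// expR_ge0.
Qed.

(** At the threshold [t], [Num.sqrt (1 - t ^+ 2) ^+ n.+1] is exactly [1 / p] and cancels the number
    of columns; [radius_inv_le] bounds what is left. *)
Lemma cap_bound_threshold p n : (1 < p)%N ->
  p%:R * cap_bound n.+2 (threshold p n.+2) <=
  Num.sqrt 8 * Num.sqrt ((2 * ln p%:R)^-1 + n.+2%:R^-1) :> R.
Proof.
move=> p1; have p0 : 0 < p%:R :> R by rewrite ltr0n ltnW.
have l0 : 0 < ln p%:R :> R by rewrite ln_gt0// ltr1n.
rewrite /cap_bound thresholdE ?(ltnW p1)//; set x := 2 * ln p%:R / _.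
have x0 : 0 < x by rewrite divr_gt0 ?mulr_gt0.
rewrite sqr_sqrtr; last by rewrite subr_ge0 ltW// expR_lt1; lra.
rewrite opprB addrC subrK sqrt_expR -expRM_natl.
have -> : n.+1%:R * (- x / 2) = - ln p%:R by rewrite /x; field.
rewrite expRN lnK ?posrE//.
rewrite [Num.sqrt 8 * _]mulrC !mulrA divff ?gt_eqF// mul1r.
apply: ler_wpM2l; first exact: sqrtr_ge0.
exact: radius_inv_le.
Qed.

(** The hypothesis [5 * ell <= d] keeps [x = 2 ell / (d - 1)] below 1/2, so the loss from shrinking
    can be measured relative to [expR (- x)]. The leading 2 bounds [1 / (1 - eps)]. *)
Lemma cap_bound_shrunk p n (ell := ln p%:R : R) (eps := ln ell / (16 * ell)) :
  1 < ell -> 5 * ell <= n.+2%:R ->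
  p%:R * cap_bound n.+2 ((1 - eps) * threshold p n.+2) <=
  2 * Num.sqrt 8 * expR (- (ln ell / 4)).
Proof.
move=> l1 dl; have l0 : 0 < ell by lra.
have p1 : (1 < p)%N.
  rewrite ltnNge; apply/negP => p1; move: l0; apply/negP; rewrite -leNgt.
  by apply: ln_le0; rewrite lern1.
have p0 : 0 < p%:R :> R by rewrite ltr0n ltnW.
have La0 : 0 < ln ell by rewrite ln_gt0.
have Lal : ln ell <= ell by apply: le_trans (ltW (ln_sublinear _)) _.
have e0 : 0 < eps by rewrite divr_gt0// mulr_gt0.
have e16 : eps <= 16^-1.
  by rewrite /eps ler_pdivrMr ?mulr_gt0//; lra.
have n0 : 0 < n.+1%:R :> R by [].
rewrite /cap_bound thresholdE ?(ltnW p1)// -/ell; set x := 2 * ell / _.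
have x0 : 0 < x by rewrite divr_gt0 ?mulr_gt0.
have x2 : x <= 2^-1.
  by rewrite ler_pdivrMr//; move: dl; rewrite -[n.+2%:R]natr1; lra.
have b0 := expR_gt0 (- x).
have b1 : expR (- x) < 1 by rewrite expR_lt1; lra.
have bx : 1 - expR (- x) <= expR (- x) * (2 * x).
  have : 1 - x <= expR (- x) by apply: expR_ge1Dx.
  nra.
set t := Num.sqrt (1 - expR (- x)).
have t0 : 0 < t by rewrite sqrtr_gt0; lra.
have t2 : t ^+ 2 = 1 - expR (- x) by rewrite sqr_sqrtr; lra.
(* Shrinking raises [1 - t ^+ 2 = expR (- x)] by at most the factor [1 + 4 eps x], by
   [1 - (1 - eps)^2 <= 2 eps] and [bx]. *)
have cap : Num.sqrt (1 - ((1 - eps) * t) ^+ 2) <= expR (- x / 2 + 2 * eps * x).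
  have -> : - x / 2 + 2 * eps * x = (- x + 4 * eps * x) / 2 by field.
  rewrite -sqrt_expR; apply: ler_wsqrtr; rewrite exprMn t2 expRD.
  have : 1 + 4 * eps * x <= expR (4 * eps * x) by exact: expR_ge1Dx.
  have : expR (- x) * (1 + 4 * eps * x) >= 1 - (1 - eps) ^+ 2 * (1 - expR (- x)).
    have := ler_wpM2l (ltW e0) bx; have := sqr_ge0 eps; nra.
  nra.
have capn : Num.sqrt (1 - ((1 - eps) * t) ^+ 2) ^+ n.+1 <=
    p%:R^-1 * expR (ln ell / 4).
  apply: (@le_trans _ _ (expR (- x / 2 + 2 * eps * x) ^+ n.+1)).
    apply: lerXn2r => //; rewrite nnegrE ?sqrtr_ge0//; exact: expR_ge0.
  rewrite -expRM_natl.
  (* Here [n.+1 * x = 2 ell], and the 16 in [eps] makes the loss [4 eps ell] equal to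
     [ln ell / 4]. *)
  have -> : n.+1%:R * (- x / 2 + 2 * eps * x) = - ell + ln ell / 4.
    by rewrite /x /eps; field; rewrite !gt_eqF.
  by rewrite expRD expRN lnK ?posrE.
have inv_le := radius_inv_le n l0; rewrite -/x -/t in inv_le.
have sq_le : Num.sqrt ((2 * ell)^-1 + n.+2%:R^-1) <= expR (- (ln ell / 2)).
  have -> : - (ln ell / 2) = - ln ell / 2 by field.
  rewrite -sqrt_expR expRN lnK ?posrE//; apply: ler_wsqrtr.
  have nl : n.+2%:R^-1 <= (2 * ell)^-1 by rewrite lef_pV2 ?posrE; lra.
  apply: le_trans (lerD (lexx _) nl) _.
  rewrite le_eqVlt; apply/orP; left; apply/eqP.
  by field; rewrite gt_eqF.
have eps_inv : (1 - eps)^-1 <= 2.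
  by rewrite -[leRHS]invrK lef_pV2 ?posrE; lra.
set A := Num.sqrt 8; set C := Num.sqrt (1 - _) ^+ _ in capn *.
have A0 : 0 <= A by exact: sqrtr_ge0.
have -> : p%:R * (A * C / ((1 - eps) * t * Num.sqrt n.+2%:R)) =
    A * (p%:R * C) * (1 - eps)^-1 * (t * Num.sqrt n.+2%:R)^-1.
  by field; rewrite !gt_eqF ?sqrtr_gt0//; lra.
have C0 : 0 <= C by rewrite exprn_ge0// sqrtr_ge0.
have pC : p%:R * C <= expR (ln ell / 4).
  rewrite -ler_pdivlMl// ; exact: capn.
have -> : 2 * A * expR (- (ln ell / 4)) =
    A * expR (ln ell / 4) * 2 * expR (- (ln ell / 2)).
  have -> : - (ln ell / 4) = ln ell / 4 + - (ln ell / 2) by field.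
  by rewrite expRD; ring.
apply: ler_pM.
- by rewrite !mulr_ge0// ?ler0n// invr_ge0; lra.
- by rewrite invr_ge0 mulr_ge0// ?sqrtr_ge0// ltW.
- apply: ler_pM => //.
  + by rewrite !mulr_ge0// ler0n.
  + by rewrite invr_ge0; lra.
  + by apply: ler_wpM2l.
- exact: le_trans sq_le.
Qed.

End estimates.

(** * Spherical laws and their bounds on the supremum norm *)

Section spherical.
Context {R : realType}.
Local Notation leb := (@lebesgue_measure R).
Local Notation mu n := (power_measure leb n).
Local Notation RR := (measurableTypeR R).

(** The common ground of the elliptical and Gaussian cases: a probability law with a radial
    density. *)
Definition spherical_law n (m : set (rvec R n) -> \bar R) : Prop :=
  m setT = 1%E /\ exists k : RR -> \bar R,
    [/\ measurable_fun setT k, forall x, (0 <= k x)%E & forall A, measurable A ->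
      m A = (\int[mu n]_(x in A) k (sqnorm x))%E].

Lemma elliptical_spherical d (T : measurableType d) (P : probability T R) n
    (Z : {RV P >-> rvec R n}) :
  elliptical Z 0 1%:M -> spherical_law (distribution P Z).
Proof.
move=> [_ [g [c [_ /measurable_int/measurable_EFinP mg [_ f0 fE]]]]].
split; first exact: probability_setT.
have qE (x : rvec R n) :
    ((col_of_tuple x - 0)^T *m invmx 1%:M *m (col_of_tuple x - 0)) 0 0 = sqnorm x.
  rewrite subr0 invmx1 mulmx1 mxE; apply: eq_bigr => i _.
  by rewrite !mxE expr2.
(* [g] is controlled only on [[0, +oo[], and [c * g] is known to be nonnegative only at values of
   [sqnorm]. Restriction and truncation at 0 give a total kernel with the same values there. *)
pose k (q : RR) : \bar R := (Num.max 0 (c * (g \_ `[0, +oo[) q))%:E.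
exists k; split.
- apply/measurable_EFinP; apply: measurable_maxr => //.
  by apply: measurable_funM => //; apply/(measurable_restrictT _ _).1.
- by move=> q; rewrite lee_fin le_max lexx.
move=> A mA; rewrite fE//; apply: eq_integral => x _; rewrite /k.
have := f0 x; rewrite /= qE => fx.
rewrite patchE mem_set ?max_r//.
  by rewrite /= in_itv/= andbT sqnorm_ge0.
Qed.

Lemma gaussian_spherical n :
  spherical_law (power_measure (normal_prob (0 : R) 1) n).
Proof.
split; first exact: gaussian_setT.
exists (fun q => (gaussian_density n q)%:E); split.
- by apply/measurable_EFinP; exact: measurable_gaussian_density.
- by move=> q; rewrite lee_fin gaussian_density_ge0.
- by move=> A mA; exact: gaussian_measureE.
Qed.

Lemma spherical_supnorm_le d (T : measurableType d) (P : probability T R) n p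
    (m : {measure set (rvec R n.+1) -> \bar R}) (X : {RV P >-> rvec R p})
    (S : 'M[R]_p) (a s : R) :
  spherical_law m -> factor_law m X S -> (forall i, S i i = 1) ->
  0 <= a -> 0 < s < 1 ->
  (P [set w | (a * s < supnorm (X w))%R] <=
   m [set x | (a ^+ 2 < sqnorm x)%R] + (p%:R * cap_bound n.+1 s)%:E)%E.
Proof.
move=> [mT [k [mk k0 mE]]] law S1 a0 s01.
apply: factor_supnorm_le law S1 a0 _ _; first by case/andP: s01.
by move=> l l1; exact: (spherical_cap mk k0 mE mT l1 s01).
Qed.

Lemma ratio_supnorm_le d (T : measurableType d) (P : probability T R) n p
    (m : {measure set (rvec R n.+2) -> \bar R}) (X : {RV P >-> rvec R p})
    (S : 'M[R]_p) (u delta : R) :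
  spherical_law m -> factor_law m X S -> (forall i, S i i = 1) ->
  0 < u -> 0 < delta -> (1 < p)%N ->
  (P [set w | (1 + delta < supnorm (X w) / rank_bound u p n.+2)%R] <=
   m [set x | (u * (1 + delta) < sqnorm x)%R] +
   (Num.sqrt 8 * Num.sqrt ((2 * ln p%:R)^-1 + n.+2%:R^-1))%:E)%E.
Proof.
move=> sph law S1 u0 delta0 p1.
have t01 := @threshold_gt0_lt1 R p n p1; have /andP[t0 t1] := t01.
pose a := (1 + delta) * Num.sqrt u.
have a0 : 0 <= a by rewrite mulr_ge0 ?sqrtr_ge0//; lra.
rewrite (_ : [set w | _] =
    [set w | (a * threshold p n.+2 < supnorm (X w))%R]); last first.
  have rb0 : 0 < Num.sqrt u * threshold p n.+2 by rewrite mulr_gt0// sqrtr_gt0.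
  rewrite rank_boundE ?(ltW u0)//; apply/seteqP.
  by split => w /=; rewrite ltr_pdivlMr// mulrA.
apply: le_trans (spherical_supnorm_le sph law S1 a0 t01) _.
apply: leeD; last by rewrite lee_fin cap_bound_threshold.
apply: le_measure; rewrite ?inE.
- by apply: measurable_bool_set; mbool.
- by apply: measurable_bool_set; mbool.
move=> x /=; apply: le_lt_trans.
(* Weakening [(1 + delta)^2] to [1 + delta] matches the event [sqnorm x / u - 1 > delta] of
   convergence in probability. *)
rewrite /a exprMn sqr_sqrtr ?(ltW u0)// [leLHS]mulrC ler_pM2r//; nra.
Qed.

End spherical.

(** * The joint limit in [p] and [d] *)

Section limits.
Context {R : realType}.

Lemma joint_oo_filter : Filter joint_oo.
Proof. exact: within_filter. Qed.

Lemma cvg_lnn : (ln n%:R : R) @[n --> \oo] --> +oo.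
Proof.
apply/cvgryPge => M; near=> n.
have nM : expR M <= n%:R by near: n; exact: nbhs_infty_ger.
by rewrite -ler_expR lnK// posrE (lt_le_trans (expR_gt0 _) nM).
Unshelve. all: end_near. Qed.

(** A squeeze: [d >= 2] holds eventually along [joint_oo], so the bound is asked only at [n.+2], and
    its square root vanishes since both coordinates tend to infinity. *)
Lemma joint_cvg0 (f : nat * nat -> \bar R) (g : nat -> \bar R) :
  (forall pd, 0 <= f pd)%E -> g n @[n --> \oo] --> 0%E ->
  (forall p n, (1 < p)%N -> (n.+2 <= p)%N ->
    (f (p, n.+2) <= g n.+2 +
      (Num.sqrt 8 * Num.sqrt ((2 * ln p%:R)^-1 + n.+2%:R^-1))%:E)%E) ->
  f @ joint_oo --> 0%E.
Proof.
move=> f0 g0 fg; have FF := joint_oo_filter.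
have F1 : fst @ joint_oo --> \oo.
  by apply: cvg_trans (@cvg_fst _ _ \oo \oo _); apply: cvg_app; exact: cvg_within.
have F2 : snd @ joint_oo --> \oo.
  by apply: cvg_trans (@cvg_snd _ _ \oo \oo _); apply: cvg_app; exact: cvg_within.
have p_gt1 : \forall pd \near joint_oo, (1 < pd.1)%N.
  by apply: (F1 [set n | (1 < n)%N]); exact: nbhs_infty_gt.
have d_gt1 : \forall pd \near joint_oo, (1 < pd.2)%N.
  by apply: (F2 [set n | (1 < n)%N]); exact: nbhs_infty_gt.
have dp : \forall pd \near joint_oo, (0 < pd.2 <= pd.1)%N.
  exact: (@withinT _ _ [set pd : nat * nat | (0 < pd.2 <= pd.1)%N]).
pose h (pd : nat * nat) : R :=
  Num.sqrt 8 * Num.sqrt ((2 * ln pd.1%:R)^-1 + pd.2%:R^-1).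
have h0 : h @ joint_oo --> (0 : R).
  rewrite -(mulr0 (Num.sqrt 8)) -[X in _ * X](@sqrtr0 R); apply: cvgM.
    exact: cvg_cst.
  apply: (@cvg_comp _ _ _ _ (@Num.sqrt R)); last exact: sqrt_continuous.
  rewrite -(addr0 0); apply: cvgD.
    apply/gtr0_cvgV0.
      by apply: filterS p_gt1 => pd p1; rewrite mulr_gt0// ln_gt0// ltr1n.
    apply: (cvg_comp (fun pd => ln pd.1%:R : R) ( *%R 2)).
      exact: (cvg_comp _ _ F1 cvg_lnn).
    by apply: gt0_cvgMry => //; exact: cvg_id.
  apply/gtr0_cvgV0; last exact: (cvg_comp _ _ F2 cvgr_idn).
  by apply: filterS d_gt1 => pd d1; rewrite ltr0n ltnW.
apply: (@squeeze_cvge _ _ _ _ (cst 0%E) _ (fun pd => g pd.2 + (h pd)%:E)%E).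
- apply: filterS2 d_gt1 dp => -[p [|[|n]]]//= _ dp.
  rewrite f0/=.
  by apply: fg => //; exact: leq_trans dp.
- exact: cvg_cst.
- rewrite -(adde0 0%E); apply: cvgeD => //.
    exact: (cvg_comp _ _ F2 g0).
  by apply/cvg_EFin => //; exact: nearW.
Qed.

End limits.

(** * The Gaussian bound without the factor [1 + delta] *)

Section shrunk.
Context {R : realType}.

(** With [a = sqrt d / (1 - eps)] and [s = (1 - eps) t], the product [a s] is exactly the level
    [sqrt d * t]. Since [(1 - eps)^-2 >= 1 + 2 eps], [gaussian_tail] applies with [b = 2 eps d]; its
    exponent [eps sqrt d / 2] is the square root over 32. *)
Lemma gaussian_supnorm_le d (T : measurableType d) (P : probability T R) n p
    (X : {RV P >-> rvec R p}) (S : 'M[R]_p) (ell := ln p%:R : R) :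
  factor_law (power_measure (normal_prob (0 : R) 1) n.+2) X S ->
  (forall i, S i i = 1) -> 1 < ell -> 5 * ell <= n.+2%:R ->
  (P [set w | (1 < supnorm (X w) / rank_bound n.+2%:R p n.+2)%R] <=
   (expR (4^-1 - Num.sqrt (ln ell ^+ 2 * n.+2%:R / ell ^+ 2) / 32) +
    2 * Num.sqrt 8 * expR (- (ln ell / 4)))%:E)%E.
Proof.
move=> law S1 l1 dl.
have l0 : 0 < ell by lra.
have p1 : (1 < p)%N.
  rewrite ltnNge; apply/negP => p1; move: l0; apply/negP; rewrite -leNgt.
  by apply: ln_le0; rewrite lern1.
have /andP[t0 t1] := @threshold_gt0_lt1 R p n p1; set t := threshold _ _ in t0 t1.
have La0 : 0 < ln ell by rewrite ln_gt0.
have Lal : ln ell <= ell by exact/ltW/ln_sublinear.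
pose eps := ln ell / (16 * ell).
have e0 : 0 < eps by rewrite divr_gt0// mulr_gt0.
have e16 : eps <= 16^-1 by rewrite /eps ler_pdivrMr ?mulr_gt0//; lra.
have d0 : 0 < n.+2%:R :> R by [].
have sd0 : 0 < Num.sqrt n.+2%:R :> R by rewrite sqrtr_gt0.
have sd2 : Num.sqrt n.+2%:R ^+ 2 = n.+2%:R :> R by rewrite sqr_sqrtr// ltW.
pose a := Num.sqrt n.+2%:R / (1 - eps); pose s := (1 - eps) * t.
have a0 : 0 <= a by rewrite divr_ge0 ?(ltW sd0)//; lra.
have s01 : 0 < s < 1 by apply/andP; split; rewrite /s; nra.
rewrite (_ : [set w | _] = [set w | (a * s < supnorm (X w))%R]); last first.
  rewrite rank_boundE ?(ltW d0)// -/t.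
  have -> : a * s = Num.sqrt n.+2%:R * t by rewrite /a /s; field; lra.
  have rb0 : 0 < Num.sqrt n.+2%:R * t by rewrite mulr_gt0.
  by apply/seteqP; split => w /=; rewrite ltr_pdivlMr// mul1r.
apply: le_trans (spherical_supnorm_le (gaussian_spherical _) law S1 a0 s01) _.
rewrite EFinD; apply: leeD; last first.
  by rewrite lee_fin; exact: cap_bound_shrunk.
apply: (@le_trans _ _ (power_measure (normal_prob (0 : R) 1) n.+2
    [set x | (n.+2%:R + 2 * eps * n.+2%:R < sqnorm x)%R])).
  apply: le_measure; rewrite ?inE.
  - by apply: measurable_bool_set; mbool.
  - by apply: measurable_bool_set; mbool.
  move=> x /=; apply: le_lt_trans.
  rewrite /a expr_div_n sd2 ler_pdivlMr; last by rewrite exprn_gt0//; lra.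
  have -> : n.+2%:R + 2 * eps * n.+2%:R = n.+2%:R * (1 + 2 * eps) :> R by ring.
  rewrite -mulrA ler_piMr ?(ltW d0)//.
  have := sqr_ge0 eps; nra.
apply: le_trans (gaussian_tail _ _) _.
rewrite lee_fin ler_expR lerD2l lerN2 le_eqVlt; apply/orP; left; apply/eqP.
rewrite sqrtrM; last by rewrite mulr_ge0// ?sqr_ge0// ltW.
rewrite sqrtrM ?sqr_ge0// sqrtr_sqr sqrtrV ?sqr_ge0// sqrtr_sqr !gtr0_norm//.
rewrite /eps -{2}sd2; field; rewrite !gt_eqF//.
Qed.

Lemma cvg_expRN (f : nat -> R) : f n @[n --> \oo] --> +oo ->
  expR (- f n) @[n --> \oo] --> (0 : R).
Proof.
move=> foo; apply: (@cvg_comp _ _ _ f (fun x : R => expR (- x)) _ +oo) => //.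
exact: cvgr_expR.
Qed.

Lemma cvgy_divr (f : nat -> R) (c : R) : 0 < c -> f n @[n --> \oo] --> +oo ->
  f n / c @[n --> \oo] --> +oo.
Proof.
move=> c0 /cvgryPge foo; apply/cvgryPge => M.
by apply: filterS (foo (M * c)) => n; rewrite ler_pdivlMr.
Qed.

Lemma cvgy_sqrt (f : nat -> R) : f n @[n --> \oo] --> +oo ->
  Num.sqrt (f n) @[n --> \oo] --> +oo.
Proof.
move=> /cvgryPge foo; apply/cvgryPge => M.
apply: filterS (foo (M ^+ 2)) => n Mf.
by rewrite (le_trans (ler_norm M))// -sqrtr_sqr ler_wsqrtr.
Qed.

(** Square [1 + ln x / 2 <= expR (ln x / 2)]. Applied to [x = ln p], it turns the growth hypothesis
    into a linear lower bound on [d]. *)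
Lemma sqr_ln_le (x : R) : 1 < x -> ln x ^+ 2 <= 4 * x.
Proof.
move=> x1; have L0 : 0 < ln x by rewrite ln_gt0.
have xE : x = expR (ln x / 2) ^+ 2.
  rewrite -expRM_natl (_ : 2%:R * _ = ln x); last by field.
  by rewrite lnK ?posrE// (lt_trans ltr01).
have y1 : 1 + ln x / 2 <= expR (ln x / 2) by exact: expR_ge1Dx.
have : (1 + ln x / 2) ^+ 2 <= expR (ln x / 2) ^+ 2.
  by rewrite ler_pXn2r ?nnegrE ?expR_ge0//; lra.
rewrite -xE; set L := ln x in L0 *; nra.
Qed.

End shrunk.

(** * Assembly of the elliptical limit and the two Gaussian limits *)

Theorem theorem4 (R : realType) :
  (forall (dZ : nat -> measure_display) (TZ : forall d, measurableType (dZ d))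
     (PZ : forall d, probability (TZ d) R) (Z : forall d, {RV (PZ d) >-> rvec R d})
     (u v : nat -> R)
     (dF : measure_display) (TF : measurableType dF) (PF : probability TF R)
     (Finf : {RV PF >-> R}),
   (forall d, (0 < d)%N -> elliptical (Z d) 0 1%:M) ->
   (forall d, 0 < u d) -> (forall d, 0 < v d) ->
   cvg_in_distribution PZ (fun d w => (sqnorm (Z d w) - u d) / v d) Finf ->
   cvg_in_probability PZ (fun d w => sqnorm (Z d w) / u d) 1 ->
   forall (dX : nat -> nat -> measure_display)
     (TX : forall p d, measurableType (dX p d))
     (PX : forall p d, probability (TX p d) R)
     (X : forall p d, {RV (PX p d) >-> rvec R p})
     (Sigma : forall p d : nat, 'M[R]_p),
   (forall p d, (0 < d <= p)%N ->
      [/\ correlation_mx (Sigma p d), \rank (Sigma p d) = d &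
          factor_law (distribution (PZ d) (Z d)) (X p d) (Sigma p d)]) ->
   forall delta : R, 0 < delta ->
   PX pd.1 pd.2 [set w |
     1 + delta < supnorm (X pd.1 pd.2 w) / rank_bound (u pd.2) pd.1 pd.2]
   @[pd --> joint_oo] --> 0%E)
  /\
  (forall (dX : nat -> nat -> measure_display)
     (TX : forall p d, measurableType (dX p d))
     (PX : forall p d, probability (TX p d) R)
     (X : forall p d, {RV (PX p d) >-> rvec R p})
     (Sigma : forall p d : nat, 'M[R]_p),
   (forall p d, (0 < d <= p)%N ->
      [/\ correlation_mx (Sigma p d), \rank (Sigma p d) = d &
          centered_normal (X p d) (Sigma p d)]) ->
   forall delta : R, 0 < delta ->
   PX pd.1 pd.2 [set w |
     1 + delta < supnorm (X pd.1 pd.2 w) / rank_bound pd.2%:R pd.1 pd.2]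
   @[pd --> joint_oo] --> 0%E)
  /\
  (forall (dX : nat -> measure_display)
     (TX : forall p, measurableType (dX p))
     (PX : forall p, probability (TX p) R)
     (X : forall p, {RV (PX p) >-> rvec R p})
     (Sigma : forall p : nat, 'M[R]_p) (d : nat -> nat),
   (forall p, (0 < p)%N ->
      [/\ correlation_mx (Sigma p), \rank (Sigma p) = d p &
          centered_normal (X p) (Sigma p)]) ->
   (ln (ln p%:R : R) ^+ 2 * (d p)%:R / ln (p%:R : R) ^+ 2) @[p --> \oo]
     --> +oo ->
   PX p [set w | supnorm (X p w) / rank_bound (d p)%:R p (d p) <= 1]
   @[p --> \oo] --> 1%E).
Proof.
split; [|split].
- move=> dZ TZ PZ Z u v dF TF PF Finf ellZ u0 _ _ cvg_u dX TX PX X Sigma H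
    delta delta0.
  apply: (@joint_cvg0 _ _ (fun d => PZ d
    [set w | (delta < `|sqnorm (Z d w) / u d - 1|)%R])).
  + by move=> pd; exact: measure_ge0.
  + exact: cvg_u.
  move=> p n p1 np /=.
  have [[_ S1] _ law] := H p n.+2 np.
  have sph := elliptical_spherical (ellZ n.+2 isT).
  have := @ratio_supnorm_le R _ _ (PX p n.+2) n p
    (distribution (PZ n.+2) (Z n.+2)) _ _ _ _ sph law S1 (u0 n.+2) delta0 p1.
  move=> /le_trans; apply.
  apply: leeD => //.
  apply: (@le_measure _ _ _ (PZ n.+2)
    [set w | (u n.+2 * (1 + delta) < sqnorm (Z n.+2 w))%R]); rewrite ?inE.
  + apply: measurable_bool_set; apply: measurable_fun_ltr => //.
    exact: (measurableT_comp (@measurable_sqnorm R n.+2)).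
  + apply: measurable_bool_set; apply: measurable_fun_ltr => //.
    apply: measurableT_comp => //; apply: measurable_funB => //.
    apply: measurable_funM => //.
    exact: (measurableT_comp (@measurable_sqnorm R n.+2)).
  + move=> w /= h; rewrite (lt_le_trans _ (ler_norm _))//.
    by rewrite ltrBrDl ltr_pdivlMr// mulrC.
- move=> dX TX PX X Sigma H delta delta0.
  (* The bound of [gaussian_tail] with [b = delta * d]. *)
  apply: (@joint_cvg0 _ _ (fun d =>
    (expR (4^-1 - delta * Num.sqrt d%:R / 4))%:E)).
  + by move=> pd; exact: measure_ge0.
  + apply/cvg_EFin; first exact: nearW.
    rewrite -(mulr0 (expR 4^-1)); under eq_fun do rewrite expRD.
    apply: cvgM; first exact: cvg_cst.
    apply: cvg_expRN; apply: cvgy_divr => //.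
    apply: (cvg_comp (fun n => Num.sqrt n%:R : R) ( *%R delta)).
      exact/cvgy_sqrt/cvgr_idn.
    by apply: gt0_cvgMry => //; exact: cvg_id.
  move=> p n p1 np /=.
  have [[_ S1] rk] := H p n.+2 np; rewrite /centered_normal rk => law.
  have d0 : 0 < n.+2%:R :> R by [].
  apply: le_trans (ratio_supnorm_le (gaussian_spherical _) law S1 d0 delta0 p1) _.
  apply: leeD => //; rewrite mulrDr mulr1.
  apply: le_trans (gaussian_tail _ _) _.
  rewrite lee_fin ler_expR lerD2l lerN2 le_eqVlt; apply/orP; left; apply/eqP.
  have sd0 : 0 < Num.sqrt n.+2%:R :> R by rewrite sqrtr_gt0.
  have : n.+2%:R = Num.sqrt n.+2%:R ^+ 2 :> R by rewrite sqr_sqrtr// ltW.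
  set w := Num.sqrt _ in sd0 *; move=> ->.
  by field; rewrite gt_eqF.
- move=> dX TX PX X Sigma d H qoo.
  pose ell p : R := ln p%:R; pose q p : R := ln (ell p) ^+ 2 * (d p)%:R / ell p ^+ 2.
  have elloo : ell p @[p --> \oo] --> +oo by exact: cvg_lnn.
  have lloo : ln (ell p) @[p --> \oo] --> +oo.
    apply/cvgryPge => M; move/cvgryPge: elloo => /(_ (expR M)).
    apply: filterS => p pM.
    by rewrite -ler_expR lnK// posrE (lt_le_trans (expR_gt0 _) pM).
  pose B p := [set w | (1 < supnorm (X p w) / rank_bound (d p)%:R p (d p))%R].
  have mB p : measurable (B p).
    apply: measurable_bool_set; apply: measurable_fun_ltr => //.
    apply: measurable_funM => //.
    exact: (measurableT_comp (@measurable_supnorm R p)).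
  have PB : PX p (B p) @[p --> \oo] --> 0%E.
    pose g p : R := expR (4^-1 - Num.sqrt (q p) / 32) +
      2 * Num.sqrt 8 * expR (- (ln (ell p) / 4)).
    have g0 : g p @[p --> \oo] --> (0 : R).
      rewrite -(addr0 0); apply: cvgD.
        rewrite -(mulr0 (expR 4^-1)); under eq_fun do rewrite expRD.
        apply: cvgM; first exact: cvg_cst.
        by apply: cvg_expRN; apply: cvgy_divr => //; exact: cvgy_sqrt.
      rewrite -(mulr0 (2 * Num.sqrt 8)).
      apply: cvgM; first exact: cvg_cst.
      by apply: cvg_expRN; exact: cvgy_divr.
    apply: (@squeeze_cvge _ _ _ _ (cst 0%E) _ (EFin \o g)).
    (* The constant 20 gives [20 ell^2 <= (ln ell)^2 d <= 4 ell d] by [sqr_ln_le], that is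
       [5 ell <= d]. *)
    - move/cvgryPge : qoo => /(_ 20) q20; move/cvgryPgt : elloo => /(_ 1) ell1.
      have p_gt0 : \forall p \near \oo, (0 < p)%N by exact: nbhs_infty_gt.
      apply: filterS3 q20 ell1 p_gt0 => p q20 ell1 p0.
      rewrite measure_ge0/=.
      have d5 : 5 * ell p <= (d p)%:R.
        have L0 : 0 < ln (ell p) by rewrite ln_gt0.
        have Ll := sqr_ln_le ell1.
        have l20 : 0 < ell p ^+ 2 by rewrite exprn_gt0//; lra.
        move: q20; rewrite -/(ell p) ler_pdivlMr// => q20.
        have d0 : 0 <= (d p)%:R :> R by rewrite ler0n.
        have := ler_wpM2r d0 Ll; nra.
      have [[_ S1] rk] := H p p0; rewrite /centered_normal rk => law.
      (* Ranks 0 and 1 contradict [5 ell <= d] with [ell > 1]. *)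
      rewrite /B /g /q; case: (d p) law d5 => [|[|n]] law d5.
      + by exfalso; lra.
      + by exfalso; lra.
      + exact: gaussian_supnorm_le law S1 ell1 d5.
    - exact: cvg_cst.
    - by apply/cvg_EFin => //; exact: nearW.
  have -> : (fun p => PX p [set w | supnorm (X p w) / rank_bound (d p)%:R p (d p) <= 1])
      = (fun p => 1 - PX p (B p))%E.
    apply/funext => p; rewrite -probability_setC//; congr (PX p _).
    by apply/seteqP; split => w /=; rewrite /B /= leNgt => /negP.
  rewrite -[X in _ --> X]sube0; apply: cvgeB => //; exact: cvg_cst.
Qed.
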